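(* Let $n$ be a positive integer, $V$ an $n$-element set, and $\mathcal{F}\subseteq 2^V$ a hereditary family with $\delta(\mathcal{F})\ge 12$. If $|\mathcal{F}|\le 5.3n+1$, then $10\mid n$, $|\mathcal{F}|=5.3n+1$, and $\mathcal{F}$ is isomorphic to $\mathcal{F}_0(n,5)$ (i.e., there is a bijection $V\to[n]$ mapping $\mathcal{F}$ onto $\mathcal{F}_0(n,5)$).
   Context: A family $\mathcal{F}\subseteq 2^V$ is hereditary if $F'\subseteq F\in\mathcal{F}$ implies $F'\in\mathcal{F}$. For $x\in V$, the degree is $d_{\mathcal{F}}(x)=|\{F\in\mathcal{F}: x\in F\}|$ and $\delta(\mathcal{F})=\min_{x\in V} d_{\mathcal{F}}(x)$. For $d\ge 5$ and $n=2dk$ with $k$ a positive integer, the family $\mathcal{F}_0(n,d)\subseteq 2^{[n]}$ is defined as follows: for $i\in[2k]$ let $U_i=\{d(i-1)+1,\dots,di\}$, and set $\mathcal{F}_0(n,d)=\mathcal{G}\cup\mathcal{H}\cup\mathcal{I}$ where $\mathcal{G}=\{S: S\subseteq U_i \text{ for some } i\in[2k],\ |S|\le d-2\}$, $\mathcal{H}=\{U_i\setminus\{di\}: i\in[2k]\}$, and $\mathcal{I}=\{\{di,d(i+1)\}: i\in\{1,3,5,\dots,2k-1\}\}$. *)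

(* Defs.v *)
From mathcomp Require Import all_boot.
Set Implicit Arguments. Unset Strict Implicit. Unset Printing Implicit Defensive.

Definition hereditary (V : finType) (F : {set {set V}}) : Prop :=
  forall A B : {set V}, B \subset A -> A \in F -> B \in F.

Definition degree (V : finType) (F : {set {set V}}) (x : V) : nat :=
  #|[set A in F | x \in A]|.

Definition min_degree_ge (V : finType) (F : {set {set V}}) (m : nat) : Prop :=
  forall x : V, m <= degree F x.

(* The ground set [n] = {1,...,n} is represented by 'I_n, where the
   ordinal x : 'I_n stands for the integer x.+1 (its "label"). *)

Definition Ublock (n d i : nat) : {set 'I_n} :=
  [set x : 'I_n | (d * (i - 1) < x.+1) && (x.+1 <= d * i)].

Definition lab (n m : nat) : {set 'I_n} := [set x : 'I_n | x.+1 == m].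

(* F_0(n,d) with k = n / (2d) (meaningful when n = 2dk) *)
Definition F0 (n d : nat) : {set {set 'I_n}} :=
  let k := n %/ (2 * d) in
  let G := [set S : {set 'I_n} |
              [exists i : 'I_(2 * k),
                 (S \subset Ublock n d i.+1) && (#|S| <= d - 2)]] in
  let H := [set S : {set 'I_n} |
              [exists i : 'I_(2 * k),
                 S == Ublock n d i.+1 :\: lab n (d * i.+1)]] in
  let I := [set S : {set 'I_n} |
              [exists i : 'I_(2 * k),
                 odd i.+1 && (S == lab n (d * i.+1) :|: lab n (d * i.+2))]] in
  G :|: H :|: I.

(* Main.v *)
(** Give every nonempty face [A] a weight 60 and share it equally among its
    elements.  The vertex [v] then receives 60, 30, 20, 15, ... for every face
    of size 0, 1, 2, 3, ... of its link, and the claim is that the average is at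
    least 318 = 60 * 5.3.  Writing (k, f2, f3) for the numbers of link faces of
    sizes 1, 2, 3, a vertex receives less than 318 only if it is of type A,
    (4, 6, 1), with 315, or of type B, (4, 5, 2), with 310.  The missing amount
    is paid by the adjacent heavy vertices: 3 to a neighbour of type A, and 4 or
    2 to a neighbour of type B.  A heavy vertex can always afford this, and has
    nothing left only if it has (k, f2, f3) = (5, 6, 0) and four neighbours of
    type A.  In the case of equality, each such vertex and its light neighbours
    form a block of size 5, and the fifth neighbour pairs up the blocks. *)
Require Import Defs.
From mathcomp Require Import all_boot zify.

Set Implicit Arguments.
Unset Strict Implicit.
Unset Printing Implicit Defensive.

(** The unit 60 turns both the shares 1, 1/2, 1/3, 1/4 and the target 5.3 into integers. The
    obstacle is the heavy type (5, 5, 1): it is worth 325 and can have three light neighbours, so it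
    cannot afford 4 for each. Hence the rate for type B is 4 only for payers with two link triples
    or six neighbours, and 2 for the others. Type B lacks 8 and must still collect it, which rests
    on the shape of its link, two triangles on a common edge: the ends of that edge lie in both
    triangles and pay the full rate, and if they are light, their neighbourhoods are so closed that
    the other two neighbours must be heavy, or even large. All bounds for heavy vertices are strict
    except in the type with nothing left, so equality in the total determines the local structure at
    every vertex. *)

Lemma sum_subsetU1 (T : finType) (a : T) (B : {set T}) (G : {set T} -> nat) :
  a \notin B ->
  \sum_(S : {set T} | S \subset a |: B) G S =
    \sum_(S : {set T} | S \subset B) G (a |: S) +
    \sum_(S : {set T} | S \subset B) G S.
Proof.
move=> aB; rewrite (bigID (fun S : {set T} => a \in S)) /=; congr (_ + _).
  rewrite (reindex_onto (fun S => a |: S) (fun S => S :\ a)) /=; last first.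
    by move=> S /andP[_ aS]; rewrite setD1K.
  apply: eq_bigl => S; rewrite setU11 andbT.
  have [aS|aS] := boolP (a \in S).
    have -> : (a |: S) :\ a == S = false.
      by apply/eqP => eS; move: aS; rewrite -eS setD11.
    rewrite andbF; apply/esym/negP => /subsetP/(_ a aS).
    by rewrite (negPf aB).
  rewrite setU1K // eqxx andbT subUset sub1set setU11 /=.
  apply/idP/idP => [/subsetP sS|sS].
    apply/subsetP => x xS; have := sS _ xS; rewrite !inE.
    by case: eqP => // ea; rewrite ea (negPf aS) in xS.
  exact: subset_trans sS (subsetU1 _ _).
apply: eq_bigl => S; apply/andP/idP => [[/subsetP sS aS]|sS].
  apply/subsetP => x xS; have := sS _ xS; rewrite !inE.
  by case: eqP => // ea; rewrite -ea xS in aS.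
split; first exact: subset_trans sS (subsetU1 _ _).
by apply/negP => /(subsetP sS); rewrite (negPf aB).
Qed.

(** Defined by recursion on the list so that, for a list of named vertices, a sum over subsets
    computes to an explicit sum of face indicators. *)
Fixpoint subseqs (T : Type) (s : seq T) : seq (seq T) :=
  if s is a :: s' then map (cons a) (subseqs s') ++ subseqs s' else [:: [::]].

Lemma sum_subset_seq (T : finType) (s : seq T) (G : {set T} -> nat) :
  uniq s ->
  \sum_(S : {set T} | S \subset [set:: s]) G S =
    \sum_(t <- subseqs s) G [set:: t].
Proof.
elim: s G => [|a s IHs] G /=.
  rewrite big_seq1 set_nil => _; rewrite (bigD1 set0) ?sub0set //=.
  by rewrite big1 ?addn0 // => S; rewrite subset0 => /andP[->].
case/andP=> ains us.
rewrite set_cons sum_subsetU1 ?inE // big_cat big_map !IHs //=; congr (_ + _).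
by apply: eq_bigr => t _; rewrite set_cons.
Qed.

Lemma subseqs_subseq (T : eqType) (s t : seq T) : t \in subseqs s -> subseq t s.
Proof.
elim: s t => [|a s IHs] t /=; first by rewrite inE => /eqP->.
rewrite mem_cat => /orP[/mapP[t' /IHs st' ->]|/IHs st]; first by rewrite /= eqxx.
exact: subseq_trans st (subseq_cons _ _).
Qed.

(** * Links and face counts *)

Section Hereditary.

Variables (V : finType) (F : {set {set V}}).
Hypothesis herF : hereditary F.
Hypothesis degF : min_degree_ge F 12.

Implicit Types (v x y z a b c d e u : V) (S T : {set V}) (s t : seq V).

Definition face s := [set:: s] \in F.

Lemma face_sub s t : all (mem s) t -> face s -> face t.
Proof.
by move=> /allP st; apply: herF; apply/subsetP => x; rewrite !inE => /st.
Qed.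

Definition link v := [set S : {set V} | (v \notin S) && (v |: S \in F)].
Definition lf j v := #|[set S in link v | #|S| == j]|.
Definition nb v := [set u : V | (u != v) && face [:: v; u]].

Lemma card_link v : #|link v| = degree F v.
Proof.
rewrite /degree -(card_in_imset (f := fun S => v |: S)); last first.
  move=> S T; rewrite !inE => /andP[vS _] /andP[vT _] eST.
  by rewrite -(setU1K vS) eST setU1K.
apply: eq_card => A; apply/imsetP/idP => [[S] | ].
  by rewrite !inE => /andP[_ SF] ->; rewrite SF setU11.
by rewrite inE => /andP[AF vA]; exists (A :\ v); rewrite ?inE ?setD1K ?eqxx.
Qed.

Lemma card_link_ge v : 12 <= #|link v|.
Proof. by rewrite card_link. Qed.

Lemma sub_link v S T : T \subset S -> S \in link v -> T \in link v.
Proof.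
move=> TS; rewrite !inE => /andP[vS SF]; apply/andP; split.
  by apply: contra vS => /(subsetP TS).
by apply: herF SF; apply: setUS.
Qed.

Lemma link_face v s : ([set:: s] \in link v) = (v \notin s) && face (v :: s).
Proof. by rewrite !inE /face set_cons. Qed.

Lemma link_nb v S : S \in link v -> S \subset nb v.
Proof.
rewrite inE => /andP[vS SF]; apply/subsetP => u uS; rewrite inE; apply/andP.
split; first by apply: contraNneq vS => <-.
apply: herF SF; apply/subsetP => y; rewrite !inE.
by case/orP=> /eqP->; rewrite ?eqxx ?uS ?orbT.
Qed.

Lemma face1 v : face [:: v].
Proof.
have: 0 < #|link v| by apply: leq_trans (card_link_ge v).
case/card_gt0P => S; rewrite inE => /andP[_]; apply: herF.
by apply/subsetP => y; rewrite !inE => /eqP->; rewrite eqxx.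
Qed.

Lemma lf0 v : lf 0 v = 1.
Proof.
rewrite /lf -(cards1 (set0 : {set V})); apply: eq_card => S; rewrite !inE.
rewrite cards_eq0; case: eqP => [->|]; rewrite ?andbF // inE setU0 /= andbT.
by have := face1 v; rewrite /face set_seq1.
Qed.

Lemma lf1 v : lf 1 v = #|nb v|.
Proof.
rewrite -(card_imset _ set1_inj); apply: eq_card => S.
rewrite inE; apply/andP/imsetP => [[SL /cards1P[u Su]]|[u uN ->]].
  exists u => //; move: SL; rewrite Su -set_seq1 link_face inE eq_sym.
  by rewrite [u \in nb _]inE.
rewrite cards1 -set_seq1 link_face inE eq_sym; split=> //.
by move: uN; rewrite inE.
Qed.

Lemma sum_link v (g : nat -> nat) (m : nat) :
  (forall S, S \in link v -> m <= #|S| -> g #|S| = 0) ->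
  \sum_(S in link v) g #|S| = \sum_(j < m) g j * lf j v.
Proof.
move=> gm; transitivity (\sum_(S in link v) \sum_(j < m) g j * (#|S| == j)).
  apply: eq_bigr => S SL; have [mS|Sm] := leqP m #|S|.
    by rewrite gm // big1 // => j _; case: eqP => //; have := ltn_ord j; lia.
  rewrite (bigD1 (Ordinal Sm)) //= eqxx muln1 big1 ?addn0 // => j nj.
  case: eqP => [e|]; last by rewrite muln0.
  by case/eqP: nj; apply: val_inj; rewrite /= -e.
rewrite exchange_big; apply: eq_bigr => j _; rewrite -big_distrr /=; congr (_ * _).
rewrite /lf -sum1_card big_mkcond [RHS]big_mkcond; apply: eq_bigr => S _ /=.
by rewrite [in RHS]inE; case: (S \in link v) => //=; case: eqP.
Qed.

(** A large link face, shrunk to size 4, makes [v] rich by itself; otherwise the degree bound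
    becomes a bound on k + f2 + f3. *)
Lemma big_face_or_count v :
  (exists2 S, S \in link v & #|S| = 4) \/
  #|link v| = 1 + #|nb v| + lf 2 v + lf 3 v.
Proof.
have [|/exists_inP nbig] := boolP [exists S in link v, 3 < #|S|].
  case/exists_inP => S SL S4; left.
  have : 0 < #|[set T : {set V} | T \subset S & #|T| == 4]|.
    by rewrite cards_draws bin_gt0.
  case/card_gt0P => T; rewrite inE => /andP[TS /eqP T4].
  by exists T => //; apply: sub_link SL.
right; rewrite -sum1_card (@sum_link v (fun=> 1) 4).
  by rewrite !big_ord_recr big_ord0 /= lf0 lf1; lia.
by move=> S SL S4; case: nbig; exists S.
Qed.

Lemma lf_ge_bin v S j : S \in link v -> 'C(#|S|, j) <= lf j v.
Proof.
move=> SL; rewrite -cards_draws; apply: subset_leq_card.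
apply/subsetP => T; rewrite !inE => /andP[TS ->]; rewrite andbT.
by have := sub_link TS SL; rewrite inE.
Qed.

(** Two distinct triples share at most one pair, so together they contain at least 3 + 3 - 1
    pairs. *)
Lemma lf3_gt1 v : 1 < lf 3 v -> 4 < lf 2 v.
Proof.
case/card_gt1P => S [T []]; rewrite !inE.
move=> /andP[SL /eqP S3] /andP[TL /eqP T3] nST.
pose D (R : {set V}) := [set P : {set V} | P \subset R & #|P| == 2].
have sD R : R \in link v -> D R \subset [set S in link v | #|S| == 2].
  move=> RL; apply/subsetP => P; rewrite 2!inE => /andP[PR ->].
  by rewrite (sub_link PR RL).
have cU : #|D S :|: D T| <= lf 2 v.
  by apply: subset_leq_card; rewrite subUset !sD // inE.
have DI : D S :&: D T \subset D (S :&: T).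
  by apply/subsetP => P; rewrite !inE subsetI => /andP[/andP[-> ->] /andP[-> _]].
have := subset_leq_card DI; rewrite !cards_draws => cI.
have ST : #|S :&: T| <= 2.
  rewrite leqNgt; apply/negP => ST3; case/eqP: nST; apply/eqP.
  have eS : S :&: T = S by apply/eqP; rewrite eqEcard subsetIl S3.
  have eT : S :&: T = T by apply/eqP; rewrite eqEcard subsetIr T3.
  by rewrite -eS eT.
have := cardsUI (D S) (D T); rewrite !cards_draws S3 T3.
by have := leq_bin2l 2 ST; have -> : 'C(3, 2) = 3 by []; rewrite binn; lia.
Qed.

Lemma sum_face_seq j v s : uniq s -> v \notin s ->
  \sum_(t <- subseqs s | size t == j) face (v :: t) =
    #|[set S in link v | (S \subset [set:: s]) && (#|S| == j)]|.
Proof.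
move=> us vs.
pose G S : nat := (S \in link v) && (#|S| == j).
have -> : \sum_(t <- subseqs s | size t == j) face (v :: t) =
          \sum_(t <- subseqs s) G [set:: t].
  rewrite big_mkcond [LHS]big_seq [RHS]big_seq.
  apply: eq_bigr => t /subseqs_subseq st.
  have vt : v \notin t by apply: contra vs; apply: (mem_subseq st).
  rewrite /G link_face vt cardsE (card_uniqP _) ?(subseq_uniq st) //=.
  by case: ifP; rewrite ?andbT ?andbF.
rewrite -sum_subset_seq // -sum1_card big_mkcond [RHS]big_mkcond.
apply: eq_bigr => S _; rewrite [in RHS]inE /G.
by case: (S \in link v); case: (S \subset _); case: (_ == _).
Qed.

Lemma lf_ge_seq j v s : uniq s -> v \notin s ->
  \sum_(t <- subseqs s | size t == j) face (v :: t) <= lf j v.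
Proof.
move=> us vs; rewrite sum_face_seq //; apply: subset_leq_card.
by apply/subsetP => S; rewrite !inE => /and3P[-> _ ->].
Qed.

Lemma lf_eq_seq j v s : uniq s -> nb v = [set:: s] ->
  lf j v = \sum_(t <- subseqs s | size t == j) face (v :: t).
Proof.
move=> us nbE; rewrite sum_face_seq //; last first.
  apply/negP => vs; have : v \in nb v by rewrite nbE inE.
  by rewrite inE eqxx.
apply: eq_card => S; rewrite [LHS]inE [RHS]inE.
case: (boolP (S \in link v)) => //= SL.
by rewrite -nbE link_nb.
Qed.

Definition weight v := 60 + 30 * #|nb v| + 20 * lf 2 v + 15 * lf 3 v.

(* [wt m] is [60 / m] on sizes at most 4 and is truncated to 0 beyond, so that
   each face distributes at most 60 among its elements. *)
Lemma sum_weight : \sum_v weight v <= 60 * (#|F| - 1).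
Proof.
pose wt m := nth 0 [:: 0; 60; 30; 20; 15] m.
have -> : \sum_v weight v = \sum_v \sum_(A in F | v \in A) wt #|A|.
  apply: eq_bigr => v _.
  rewrite (reindex_onto (fun S => v |: S) (fun A => A :\ v)) /=; last first.
    by move=> A /andP[_ vA]; rewrite setD1K.
  transitivity (\sum_(S in link v) wt #|S|.+1).
    rewrite (@sum_link v (fun m => wt m.+1) 4); last first.
      by move=> S _; case: #|S| => [|[|[|[|?]]]] // _; rewrite /wt nth_default.
    by rewrite !big_ord_recr big_ord0 /= /weight lf0 lf1 /wt /=; lia.
  apply: eq_big => S; last by rewrite inE => /andP[vS _]; rewrite cardsU1 vS.
  rewrite inE setU11 andbT; have [vS|vS] := boolP (v \in S).
    rewrite (_ : (_ == S) = false) ?andbF //; apply/eqP => eS.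
    by move: vS; rewrite -eS setD11.
  by rewrite setU1K // eqxx andbT.
(* Double counting: a face of size m hands out [m * wt m], at most 60, and the empty face has no
   vertex to serve, whence [#|F| - 1]. *)
rewrite (exchange_big_dep (fun A => A \in F)) /=; last by move=> v A _ /andP[].
have [F0|/set0Pn[A0 A0F]] := eqVneq F set0.
  by rewrite F0 big1 // => A; rewrite inE.
have F0 : set0 \in F by apply: herF A0F; apply: sub0set.
rewrite (bigD1 set0) //= (eq_bigr (fun=> 0)) => [|v _]; last by rewrite cards0.
rewrite big1 // add0n (cardsD1 set0 F) F0 addKn -sum1_card big_distrr /=.
have -> : \sum_(A in F :\ set0) 60 * 1 = \sum_(A in F | A != set0) 60.
  by apply: eq_bigl => A; rewrite !inE andbC.
apply: leq_sum => A /andP[AF _].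
rewrite (eq_bigl (mem A)) => [|v]; last by rewrite AF.
rewrite sum_nat_const /wt.
by case: #|A| => [|[|[|[|[|m]]]]] //; rewrite nth_default // muln0.
Qed.

(** Reads a disequality of vertices off a [uniq] hypothesis: identifying the two makes that
    hypothesis compute to false. *)
Ltac neq :=
  let E := fresh in
  apply/eqP => E;
  match goal with
  | U : is_true (uniq _) |- _ =>
      solve [by move: U; rewrite ?E /= !inE ?eqxx ?orbT ?andbF ?E
            |by move: U; rewrite -?E /= !inE ?eqxx ?orbT ?andbF]
  end.

Ltac uniq_from :=
  rewrite /= ?inE ?negb_or ?andbT; repeat (apply/andP; split); neq.

Ltac face_by H := by apply: (face_sub _ H); rewrite /= !inE !eqxx ?orbT.

Ltac set_perm :=
  let u := fresh in
  apply/setP => u; rewrite !inE;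
  repeat match goal with |- context [u == ?x] => case: (u == x) end;
  by [].

Lemma face_nb s v u : face s -> v \in s -> u \in s -> u != v -> u \in nb v.
Proof.
move=> fs vs us uv; rewrite inE uv; apply: face_sub fs.
by rewrite /= vs us.
Qed.

Lemma nb_sym u v : (u \in nb v) = (v \in nb u).
Proof.
by rewrite !inE eq_sym; congr (_ && _); apply/idP/idP => H; face_by H.
Qed.

Lemma nb_eq_seq v s :
  uniq s -> all (mem (nb v)) s -> size s = #|nb v| -> nb v = [set:: s].
Proof.
move=> us /allP sn ss; apply/esym/eqP; rewrite eqEcard [#|[set:: s]|]cardsE.
rewrite (card_uniqP us) ss leqnn andbT.
by apply/subsetP => u; rewrite inE => /sn.
Qed.

(** The link lies in the powerset of the neighbourhood, and 2^3 < 12. *)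
Lemma card_nb_gt3 v : 3 < #|nb v|.
Proof.
have : #|link v| <= 2 ^ #|nb v|.
  rewrite -card_powerset; apply: subset_leq_card.
  by apply/subsetP => S /link_nb; rewrite powersetE.
have := card_link_ge v.
by case: #|nb v| => [|[|[|[|m]]]] //=; lia.
Qed.

Lemma nb_extend v a b c :
  #|nb v| = 4 -> uniq [:: a; b; c] -> all (mem (nb v)) [:: a; b; c] ->
  exists e, uniq [:: v; a; b; c; e] /\ nb v = [set:: [:: a; b; c; e]].
Proof.
move=> n4 u3 a3.
have sub : [set:: [:: a; b; c]] \subset nb v.
  by apply/subsetP => u; rewrite inE => ui; apply: (allP a3).
have : 0 < #|nb v :\: [set:: [:: a; b; c]]|.
  by rewrite cardsD (setIidPr sub) n4 cardsE (card_uniqP u3).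
case/card_gt0P => e; rewrite !inE negb_or => /andP[eabc en].
have u4 : uniq [:: a; b; c; e].
  rewrite -[[:: a; b; c; e]]/(rcons [:: a; b; c] e) rcons_uniq u3 andbT.
  by rewrite !inE negb_or.
have a4 : all (mem (nb v)) [:: a; b; c; e].
  by move: a3 => /= /and4P[-> -> -> _] /=; rewrite inE en.
exists e; split; last by apply: nb_eq_seq; rewrite ?n4.
rewrite cons_uniq u4 andbT; apply/negP => /(allP a4).
by rewrite /= inE eqxx.
Qed.

(** With four neighbours f2 and f3 are sums of explicit bits; the case analyses below consist in
    deciding these bits. *)
Lemma lf_nb4 v a b c d :
  uniq [:: a; b; c; d] -> nb v = [set:: [:: a; b; c; d]] ->
  lf 2 v = face [:: v; a; b] + face [:: v; a; c] + face [:: v; a; d]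
         + face [:: v; b; c] + face [:: v; b; d] + face [:: v; c; d] /\
  lf 3 v = face [:: v; a; b; c] + face [:: v; a; b; d]
         + face [:: v; a; c; d] + face [:: v; b; c; d].
Proof.
move=> u4 nE; split; rewrite (lf_eq_seq _ u4 nE) -big_filter /=.
  by do 6!rewrite big_cons /=; rewrite big_nil addn0 !addnA.
by do 4!rewrite big_cons /=; rewrite big_nil addn0 !addnA.
Qed.

(** * Light vertices *)

(** The link of type A is a complete graph on four vertices with one triangle filled; that of type B
    is two filled triangles glued along an edge. *)
Definition typeA v := [&& #|nb v| == 4, lf 2 v == 6 & lf 3 v == 1].
Definition typeB v := [&& #|nb v| == 4, lf 2 v == 5 & lf 3 v == 2].
Definition light v := typeA v || typeB v.

Lemma light_nb4 v : light v -> #|nb v| = 4.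
Proof. by case/orP => /and3P[/eqP]. Qed.

Lemma typeA_pair x y z : typeA x -> y \in nb x -> z \in nb x -> y != z ->
  face [:: x; y; z].
Proof.
case/and3P => /eqP n4 /eqP f2 _ yn zn yz.
have eP : [set S in link x | #|S| == 2] =
          [set S : {set V} | S \subset nb x & #|S| == 2].
  apply/eqP; rewrite eqEcard cards_draws n4 -/(lf 2 x) f2 andbT.
  by apply/subsetP => S; rewrite 2!inE => /andP[/link_nb-> ->].
have : [set y; z] \in [set S in link x | #|S| == 2].
  by rewrite eP inE subUset !sub1set yn zn cards2 yz.
by rewrite !inE => /andP[/andP[_]] + _; rewrite /face !set_cons set_nil setU0.
Qed.

Lemma typeA_struct x : typeA x ->
  exists a b c d, [/\ uniq [:: x; a; b; c; d],
    nb x = [set:: [:: a; b; c; d]] & face [:: x; a; b; c]].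
Proof.
case/and3P => /eqP n4 _ /eqP f3.
have : 0 < lf 3 x by rewrite f3.
case/card_gt0P => S; rewrite inE => /andP[SL S3].
have eS : [set:: enum S] = S by apply/setP => u; rewrite inE mem_enum.
have := enum_uniq S; have := cardE S; rewrite (eqP S3).
case E: (enum S) => [|a [|b [|c [|]]]] // _ uS.
move: SL; rewrite -eS E link_face => /andP[xS fS].
have [|d [ud dE]] := nb_extend n4 uS.
  have := link_nb (_ : [set:: [:: a; b; c]] \in link x).
  rewrite link_face xS fS => /(_ isT) /subsetP sub.
  by apply/allP => u us; apply: sub; rewrite inE.
by exists a, b, c, d.
Qed.

(** Names the vertices of the link: [a], [b] span the common edge of the two triangles, and [c], [d]
    form the missing pair. Swapping [a] with [b] or [c] with [d] is a symmetry. *)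
Definition typeB_at x a b c d :=
  [/\ uniq [:: x; a; b; c; d], nb x = [set:: [:: a; b; c; d]],
      face [:: x; a; b; c], face [:: x; a; b; d] & ~~ face [:: x; c; d]].

(** One of the six pairs is missing; the two triples containing it are not in the link, so the other
    two are. *)
Lemma typeB_struct x : typeB x -> exists a b c d, typeB_at x a b c d.
Proof.
case/and3P => /eqP n4 /eqP f2 /eqP f3.
have [S] : exists S : {set V}, [&& S \subset nb x, #|S| == 2 & S \notin link x].
  apply/existsP; apply: contraT; rewrite negb_exists => /forallP H.
  have : #|[set S : {set V} | S \subset nb x & #|S| == 2]| <= lf 2 x.
    apply: subset_leq_card; apply/subsetP => S; rewrite 2!inE => /andP[Sn S2].
    by have := H S; rewrite Sn S2 /= negbK => ->.
  by rewrite cards_draws n4 f2.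
case/and3P => Sn /cards2P[c [d [cd SE]]] SL.
have : #|nb x :\: S| = 2 by rewrite cardsD (setIidPr Sn) n4 SE cards2 cd.
move/eqP/cards2P => [a [b [ab abE]]].
have nE : nb x = [set:: [:: a; b; c; d]].
  rewrite -(setID (nb x) S) (setIidPr Sn) abE SE; set_perm.
have u4 : uniq [:: a; b; c; d].
  have aS : a \in nb x :\: S by rewrite abE !inE eqxx.
  have bS : b \in nb x :\: S by rewrite abE !inE eqxx orbT.
  move: aS bS; rewrite SE !inE !negb_or => /and3P[/andP[ac ad] _ _].
  case/and3P => /andP[bc bd] _ _.
  by rewrite /= !inE !negb_or ab ac ad bc bd cd.
have xs : x \notin [:: a; b; c; d].
  apply/negP => xs; have : x \in nb x by rewrite nE inE.
  by rewrite inE eqxx.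
have ncd : ~~ face [:: x; c; d].
  move: SL; rewrite SE (_ : [set c; d] = [set:: [:: c; d]]).
    rewrite link_face negb_and negbK => /orP[] //.
    by move=> xcd; case/negP: xs; move: xcd; rewrite !inE => /orP[]->; rewrite ?orbT.
  set_perm.
have [_] := lf_nb4 u4 nE; rewrite f3.
have -> : face [:: x; a; c; d] = false by apply: contraNF ncd => H; face_by H.
have -> : face [:: x; b; c; d] = false by apply: contraNF ncd => H; face_by H.
case E1 : (face [:: x; a; b; c]); case E2 : (face _) => // _.
by exists a, b, c, d; split => //; rewrite cons_uniq xs.
Qed.

Lemma typeB_atC x a b c d : typeB_at x a b c d -> typeB_at x b a c d.
Proof.
case=> U nE f1 f2 f3; split => //; try by [face_by f1|face_by f2].
  uniq_from.
by rewrite nE; set_perm.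
Qed.

Lemma typeB_atS x a b c d : typeB_at x a b c d -> typeB_at x a b d c.
Proof.
case=> U nE f1 f2 f3; split => //.
- uniq_from.
- by rewrite nE; set_perm.
by apply: contra f3 => H; face_by H.
Qed.

Lemma typeB_at_nb1 x a b c d : typeB_at x a b c d ->
  all (mem (nb a)) [:: x; b; c; d] /\ all (mem (nb c)) [:: x; a; b].
Proof.
case=> U nE f1 f2 f3; split; rewrite /= !andbT; repeat (apply/andP; split).
- by apply: (face_nb f1); rewrite ?inE ?eqxx ?orbT //; neq.
- by apply: (face_nb f1); rewrite ?inE ?eqxx ?orbT //; neq.
- by apply: (face_nb f1); rewrite ?inE ?eqxx ?orbT //; neq.
- by apply: (face_nb f2); rewrite ?inE ?eqxx ?orbT //; neq.
- by apply: (face_nb f1); rewrite ?inE ?eqxx ?orbT //; neq.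
- by apply: (face_nb f1); rewrite ?inE ?eqxx ?orbT //; neq.
by apply: (face_nb f1); rewrite ?inE ?eqxx ?orbT //; neq.
Qed.

Lemma typeB_at_lf3 x a b c d : typeB_at x a b c d -> 1 < lf 3 a /\ 0 < lf 3 c.
Proof.
case=> U nE f1 f2 f3; split; last first.
  apply/card_gt0P; exists [set:: [:: x; a; b]].
  rewrite inE link_face cardsE (card_uniqP _) //=; last uniq_from.
  rewrite andbT; apply/andP; split; last by face_by f1.
  by rewrite !inE !negb_or; repeat (apply/andP; split); neq.
apply/card_gt1P; exists [set:: [:: x; b; c]], [set:: [:: x; b; d]]; split.
- rewrite inE link_face cardsE (card_uniqP _) //=; last uniq_from.
  rewrite andbT; apply/andP; split; last by face_by f1.
  by rewrite !inE !negb_or; repeat (apply/andP; split); neq.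
- rewrite inE link_face cardsE (card_uniqP _) //=; last uniq_from.
  rewrite andbT; apply/andP; split; last by face_by f2.
  by rewrite !inE !negb_or; repeat (apply/andP; split); neq.
apply/eqP => /setP/(_ c); rewrite !inE eqxx !orbT => /esym; apply/negP.
by rewrite !negb_or; repeat (apply/andP; split); neq.
Qed.

(** The known faces already give [a] four neighbours and two link triples, so a light [a] is of type
    B. They also give it five pairs, which leaves no room for [c d]. *)
Lemma typeB_at_light x a b c d : typeB_at x a b c d -> light a ->
  nb a = [set:: [:: x; b; c; d]] /\ ~~ face [:: a; c; d].
Proof.
move=> B la; have [na _] := typeB_at_nb1 B; have [f3a _] := typeB_at_lf3 B.
have [U nE f1 f2 f3] := B.
have u4 : uniq [:: x; b; c; d] by uniq_from.
have nEa : nb a = [set:: [:: x; b; c; d]].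
  by apply: nb_eq_seq; rewrite ?light_nb4.
split => //; case/orP: la => /and3P[_ /eqP c2 /eqP c3]; first by rewrite c3 in f3a.
have [+ _] := lf_nb4 u4 nEa; rewrite c2.
have -> : face [:: a; x; b] by face_by f1.
have -> : face [:: a; x; c] by face_by f1.
have -> : face [:: a; x; d] by face_by f2.
have -> : face [:: a; b; c] by face_by f1.
have -> : face [:: a; b; d] by face_by f2.
by case: face.
Qed.

(* A fourth neighbour of [c] would have to be [d], which no face at [x] or [a]
   containing [c] allows; this leaves at most four pairs in the link of [c]. *)
Lemma typeB_heavy3 x a b c d : typeB_at x a b c d -> light a -> ~~ light c.
Proof.
move=> B la; apply/negP => lc; have [nEa nacd] := typeB_at_light B la.
have [_ nc] := typeB_at_nb1 B; have [U nE f1 f2 f3] := B.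
have [|e [Ue nEc]] := nb_extend (light_nb4 lc) _ nc; first by uniq_from.
have ue : uniq [:: x; a; b; e] by move: Ue; rewrite cons_uniq => /andP[].
have [+ _] := lf_nb4 ue nEc.
have c2 : 4 < lf 2 c by case/orP: lc => /and3P[_ /eqP->].
have nxe : face [:: c; x; e] = false.
  apply/negP => cxe; have : e \in nb x.
    by apply: (face_nb cxe); rewrite ?inE ?eqxx ?orbT //; clear U; neq.
  rewrite nE !inE => /or4P[] /eqP eE; last by case/negP: f3; rewrite -eE; face_by cxe.
  - by move: Ue; rewrite eE /= !inE eqxx ?orbT ?andbF.
  - by move: Ue; rewrite eE /= !inE eqxx ?orbT ?andbF.
  by move: Ue; rewrite eE /= !inE eqxx ?orbT ?andbF.
have nae : face [:: c; a; e] = false.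
  apply/negP => cae; have : e \in nb a.
    by apply: (face_nb cae); rewrite ?inE ?eqxx ?orbT //; clear U; neq.
  rewrite nEa !inE => /or4P[] /eqP eE; last by case/negP: nacd; rewrite -eE; face_by cae.
  - by move: Ue; rewrite eE /= !inE eqxx ?orbT ?andbF.
  - by move: Ue; rewrite eE /= !inE eqxx ?orbT ?andbF.
  by move: Ue; rewrite eE /= !inE eqxx ?orbT ?andbF.
by rewrite nxe nae => E; move: c2; rewrite E; do 4!case: face.
Qed.

(* With [x], [a], [b] closed, no face at [c] mixes [x, a, b] with the other
   neighbours of [c], so at least four faces must live on the latter. *)
Lemma typeB_nb_gt5 x a b c d : typeB_at x a b c d -> light a -> light b ->
  5 < #|nb c|.
Proof.
move=> B la lb; rewrite leqNgt; apply/negP => nc5.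
have [nEa nacd] := typeB_at_light B la.
have [nEb nbcd] := typeB_at_light (typeB_atC B) lb.
have [_ nc] := typeB_at_nb1 B; have [U nE f1 f2 f3] := B.
pose R := [set:: [:: x; a; b]].
have cR : #|R| = 3 by rewrite cardsE (card_uniqP _) //; uniq_from.
have Rn : R \subset nb c by apply/subsetP => u; rewrite inE => /(allP nc).
have closed y z : face [:: c; y; z] -> y \in R -> z \notin R -> z != c -> False.
  move=> cyz yR zR zc.
  have zy : z != y by apply: contraNneq zR => ->.
  have zn : z \in nb y by apply: (face_nb cyz); rewrite ?inE ?eqxx ?orbT.
  move: zR; rewrite !inE !negb_or => /and3P[/negPf zx /negPf za /negPf zb].
  have zd : z = d -> False.
    move=> zd; rewrite zd in cyz; move: yR; rewrite !inE => /or3P[] /eqP yE.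
    - by case/negP: f3; rewrite yE in cyz; face_by cyz.
    - by case/negP: nacd; rewrite yE in cyz; face_by cyz.
    by case/negP: nbcd; rewrite yE in cyz; face_by cyz.
  apply: zd; apply/eqP; move: zn; have : y \in [:: x; a; b] by move: yR; rewrite inE.
  rewrite 3!in_cons orbF => /or3P[] /eqP ->.
  - by rewrite nE !inE za zb (negPf zc).
  - by rewrite nEa !inE zx zb (negPf zc).
  by rewrite nEb !inE zx za (negPf zc).
have sub : link c \subset powerset R :|: powerset (nb c :\: R).
  apply/subsetP => S SL; rewrite inE !powersetE.
  have [//|/subsetPn[z zS zR]] := boolP (S \subset R).
  rewrite subsetD (link_nb SL) /=; apply/pred0P => y /=; apply/negP => /andP[yS yR].
  have cS : c \notin S by move: SL; rewrite inE => /andP[].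
  apply: (closed y z) => //; last by apply: contraNneq cS => <-.
  move: SL; rewrite inE => /andP[_]; apply: herF; apply/subsetP => u.
  by rewrite !inE => /or3P[] /eqP->; rewrite ?yS ?zS ?eqxx ?orbT.
(* With at most five neighbours, the two powersets, which share the empty set, have at most 8 + 4 -
   1 = 11 members in all, less than 12. *)
have := subset_leq_card sub.
have := cardsUI (powerset R) (powerset (nb c :\: R)).
have : 0 < #|powerset R :&: powerset (nb c :\: R)|.
  by apply/card_gt0P; exists set0; rewrite inE !powersetE !sub0set.
rewrite !card_powerset cR cardsD (setIidPr Rn) cR.
have := card_link_ge c.
have : 2 ^ (#|nb c| - 3) <= 2 ^ 2 by rewrite leq_exp2l // leq_subLR.
rewrite -[2 ^ 3]/8 -[2 ^ 2]/4; move: (2 ^ _) => p.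
move: #|link c| #|powerset R :&: _| #|powerset R :|: _| => q r t; clear; lia.
Qed.

(** If all four neighbours were light, [x] and they would be closed under adjacency around [a] and
    [d]. As [x a b c] is the only four-element face at [x], the light vertex [d] needs the face
    [d a b c]. Then [a] has all six pairs and two triples, which is neither type. *)
Lemma typeA_has_heavy x : typeA x -> exists2 v, v \in nb x & ~~ light v.
Proof.
move=> Ax; apply/exists_inP; apply: contraT.
rewrite negb_exists_in => /forall_inP H.
have L v : v \in nb x -> light v by move=> /H; rewrite negbK.
have [a [b [c [d [U nE f1]]]]] := typeA_struct Ax.
have [/eqP n4 /eqP c2 /eqP c3] := and3P Ax.
have u4 : uniq [:: a; b; c; d] by move: U; rewrite cons_uniq => /andP[].
have P y z : y \in [:: a; b; c; d] -> z \in [:: a; b; c; d] -> y != z ->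
    face [:: x; y; z].
  by move=> yn zn; apply: typeA_pair => //; rewrite nE in_set.
have mem1 : a \in [:: a; b; c; d] by rewrite inE eqxx.
have mem2 : b \in [:: a; b; c; d] by rewrite !inE eqxx orbT.
have mem3 : c \in [:: a; b; c; d] by rewrite !inE eqxx !orbT.
have mem4 : d \in [:: a; b; c; d] by rewrite !inE eqxx !orbT.
have nEd : nb d = [set:: [:: x; a; b; c]].
  apply: nb_eq_seq; [uniq_from| |by rewrite light_nb4 // L // nE in_set mem4].
  rewrite /= andbT; repeat (apply/andP; split).
  - by apply: (face_nb (P a d _ _ _)); rewrite ?inE ?eqxx ?orbT //; neq.
  - by apply: (face_nb (P a d _ _ _)); rewrite ?inE ?eqxx ?orbT //; neq.
  - by apply: (face_nb (P b d _ _ _)); rewrite ?inE ?eqxx ?orbT //; neq.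
  by apply: (face_nb (P c d _ _ _)); rewrite ?inE ?eqxx ?orbT //; neq.
have nEa : nb a = [set:: [:: x; b; c; d]].
  apply: nb_eq_seq; [uniq_from| |by rewrite light_nb4 // L // nE in_set mem1].
  rewrite /= andbT; repeat (apply/andP; split).
  - by apply: (face_nb (P a d _ _ _)); rewrite ?inE ?eqxx ?orbT //; neq.
  - by apply: (face_nb (P a b _ _ _)); rewrite ?inE ?eqxx ?orbT //; neq.
  - by apply: (face_nb (P a c _ _ _)); rewrite ?inE ?eqxx ?orbT //; neq.
  by apply: (face_nb (P a d _ _ _)); rewrite ?inE ?eqxx ?orbT //; neq.
have [_] := lf_nb4 u4 nE; rewrite c3 f1.
case xabd: (face [:: x; a; b; d]); first by do 2!case: face.
case xacd: (face [:: x; a; c; d]); first by case: face.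
case xbcd: (face [:: x; b; c; d]) => // _.
have ud : uniq [:: x; a; b; c] by uniq_from.
have ua : uniq [:: x; b; c; d] by uniq_from.
have := L _ (_ : d \in nb x); rewrite nE in_set mem4 => /(_ isT) ld.
have := L _ (_ : a \in nb x); rewrite nE in_set mem1 => /(_ isT) la.
have dabc : face [:: d; a; b; c].
  have : 0 < lf 3 d by case/orP: ld => /and3P[_ _ /eqP->].
  have [_ ->] := lf_nb4 ud nEd.
  have -> : face [:: d; x; a; b] = false by apply: contraFF xabd => h; face_by h.
  have -> : face [:: d; x; a; c] = false by apply: contraFF xacd => h; face_by h.
  have -> : face [:: d; x; b; c] = false by apply: contraFF xbcd => h; face_by h.
  by case: face.
have [a2 a3] := lf_nb4 ua nEa.
have: lf 2 a = 6.
  rewrite a2.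
  have -> : face [:: a; x; b] by face_by f1.
  have -> : face [:: a; x; c] by face_by f1.
  have -> : face [:: a; x; d] by have h : face [:: x; a; d]; [apply: P => //; neq|face_by h].
  have -> : face [:: a; b; c] by face_by f1.
  have -> : face [:: a; b; d] by face_by dabc.
  by have -> : face [:: a; c; d] by face_by dabc.
have: 1 < lf 3 a.
  rewrite a3.
  have -> : face [:: a; x; b; c] by face_by f1.
  have -> : face [:: a; b; c; d] by face_by dabc.
  by do 2!case: face.
by case/orP: la => /and3P[_ /eqP-> /eqP->].
Qed.

(** Each of the four neighbours lies in one of the two triangles. This keeps type B away from
    vertices with f3 = 0 and locates it when f3 = 1. *)
Lemma typeB_nb_face x v : typeB x -> v \in nb x ->
  exists S, [/\ S \in link v, #|S| = 3 & x \in S].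
Proof.
move=> /typeB_struct[a [b [c [d B]]]].
have facea p q r (w : V) : typeB_at x p q r w ->
    exists S, [/\ S \in link p, #|S| = 3 & x \in S].
  case=> U _ f1 _ _; exists [set:: [:: x; q; r]].
  split; last by rewrite !inE eqxx.
    rewrite link_face; apply/andP; split; last by face_by f1.
    by rewrite !inE !negb_or; repeat (apply/andP; split); neq.
  by rewrite cardsE (card_uniqP _) //; uniq_from.
have facec p q r (w : V) : typeB_at x p q r w ->
    exists S, [/\ S \in link r, #|S| = 3 & x \in S].
  case=> U _ f1 _ _; exists [set:: [:: x; p; q]].
  split; last by rewrite !inE eqxx.
    rewrite link_face; apply/andP; split; last by face_by f1.
    by rewrite !inE !negb_or; repeat (apply/andP; split); neq.
  by rewrite cardsE (card_uniqP _) //; uniq_from.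
have [_ -> _ _ _] := B; rewrite in_set 4!in_cons orbF.
case/or4P => /eqP ->.
- exact: facea B.
- exact: facea (typeB_atC B).
- exact: facec B.
exact: facec (typeB_atS B).
Qed.

Lemma typeB_nb_lf3 x v : typeB x -> v \in nb x -> 0 < lf 3 v.
Proof.
move=> Bx vx; have [S [SL S3 _]] := typeB_nb_face Bx vx.
by apply/card_gt0P; exists S; rewrite inE SL S3.
Qed.

Lemma typeB_not_typeA x : typeB x -> ~~ typeA x.
Proof. by case/and3P => _ /eqP f2 _; rewrite /typeA f2 andbF. Qed.

(** * Payments *)

Definition pay v x :=
  if [&& ~~ light v, light x & x \in nb v] then
    if typeA x then 3 else if (1 < lf 3 v) || (5 < #|nb v|) then 4 else 2
  else 0.

Definition outlay v := \sum_x pay v x.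
Definition income x := \sum_v pay v x.

Lemma income_ge s x : uniq s -> \sum_(v <- s) pay v x <= income x.
Proof.
move=> us; rewrite big_uniq // [leqLHS]big_mkcond.
by apply: leq_sum => v _; case: ifP.
Qed.

Lemma income_typeA x : typeA x -> 3 <= income x.
Proof.
move=> Ax; have [v vx hv] := typeA_has_heavy Ax.
have := @income_ge [:: v] x isT; rewrite big_seq1.
by rewrite /pay hv /light Ax nb_sym vx.
Qed.

(** Split on the common edge [a b]. If both ends are heavy they pay 4 + 4. If one is light, the
    other pays 4 and [c], [d] at least 2 each. If both are light, [c] and [d] have more than five
    neighbours and pay 4 each. *)
Lemma income_typeB x : typeB x -> 8 <= income x.
Proof.
move=> Bx; have [a [b [c [d B]]]] := typeB_struct Bx.
have [U nE _ _ _] := B.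
have u4 : uniq [:: a; b; c; d] by move: U; rewrite cons_uniq => /andP[].
apply: leq_trans (income_ge x u4).
rewrite !big_cons big_nil addn0.
have P v : v \in [:: a; b; c; d] -> ~~ light v ->
    pay v x = if (1 < lf 3 v) || (5 < #|nb v|) then 4 else 2.
  move=> vs hv; rewrite /pay hv {1}/light Bx orbT nb_sym nE in_set vs /=.
  by rewrite (negPf (typeB_not_typeA Bx)).
have Pa : ~~ light a -> pay a x = 4.
  move=> ha; rewrite P ?inE ?eqxx //.
  by have [-> _] := typeB_at_lf3 B.
have Pb : ~~ light b -> pay b x = 4.
  move=> hb; rewrite P ?inE ?eqxx ?orbT //.
  by have [-> _] := typeB_at_lf3 (typeB_atC B).
have [la|/Pa ->] := boolP (light a).
  have hc := typeB_heavy3 B la; have hd := typeB_heavy3 (typeB_atS B) la.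
  rewrite (P c) ?inE ?eqxx ?orbT // (P d) ?inE ?eqxx ?orbT //.
  have [lb|/Pb ->] := boolP (light b).
    rewrite (typeB_nb_gt5 B la lb) (typeB_nb_gt5 (typeB_atS B) la lb) !orbT.
    by rewrite addnA leq_addl.
  by move: (pay a x) => p; do 2!case: ifP => _; lia.
have [lb|/Pb ->] := boolP (light b); last by rewrite addnA leq_addr.
have hc := typeB_heavy3 (typeB_atC B) lb.
have hd := typeB_heavy3 (typeB_atS (typeB_atC B)) lb.
rewrite (P c) ?inE ?eqxx ?orbT // (P d) ?inE ?eqxx ?orbT //.
by do 2!case: ifP => _; lia.
Qed.

(** * Bounds on what a heavy vertex pays *)

Definition lnb v := [set x in nb v | light x].

Lemma outlay_le v m : (forall x, x \in lnb v -> pay v x <= m) ->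
  outlay v <= m * #|lnb v|.
Proof.
move=> le_m; rewrite mulnC -sum_nat_const [leqRHS]big_mkcond.
apply: leq_sum => x _; case: ifP => [/le_m //|].
by rewrite inE /pay => H; case: and3P => // -[_ lx xv]; rewrite lx xv in H.
Qed.

Lemma lnb_sub v : lnb v \subset nb v.
Proof. by apply/subsetP => x; rewrite inE => /andP[]. Qed.

Lemma pay_le4 v x : pay v x <= 4.
Proof. by rewrite /pay; do 3?case: ifP => _. Qed.

Lemma lf2_ge4 v a b c d : uniq [:: v; a; b; c; d] ->
  face [:: v; a; b] + face [:: v; a; c] + face [:: v; a; d]
    + face [:: v; b; c] + face [:: v; b; d] + face [:: v; c; d] <= lf 2 v.
Proof.
rewrite cons_uniq => /andP[vs us].
have := lf_ge_seq 2 us vs; rewrite -big_filter /=.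
by do 6!rewrite big_cons /=; rewrite big_nil addn0 !addnA.
Qed.

(** All pairs at [v] are faces, so light [x] and [z] have all their neighbours among these five
    vertices. Having two triples, [x] is of type B, and its missing pair must be [z w]. Then [z]
    misses the pair [x w] and can keep only the triple [v x y], which is neither type. *)
Lemma nonadjacent_lights v x y z w :
  uniq [:: v; x; y; z; w] -> nb v = [set:: [:: x; y; z; w]] ->
  lf 2 v = 6 -> lf 3 v = 2 ->
  face [:: v; x; y; z] -> face [:: v; x; y; w] -> light x -> ~~ light z.
Proof.
move=> U nE f2 f3 xyz xyw lx; apply/negP => lz.
have u4 : uniq [:: x; y; z; w] by move: U; rewrite cons_uniq => /andP[].
have [+ +] := lf_nb4 u4 nE; rewrite f2 f3 xyz xyw.
case vzw: (face [:: v; z; w]); last by do 5!case: face.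
case vxw: (face [:: v; x; w]); last by do 4!case: face.
case xzw: (face [:: v; x; z; w]); first by do 1!case: face.
case yzw: (face [:: v; y; z; w]) => // _ _.
have nEx : nb x = [set:: [:: v; y; z; w]].
  apply: nb_eq_seq; [uniq_from| |by rewrite light_nb4].
  rewrite /= andbT; repeat (apply/andP; split).
  - by apply: (face_nb xyz); rewrite ?inE ?eqxx ?orbT //; neq.
  - by apply: (face_nb xyz); rewrite ?inE ?eqxx ?orbT //; neq.
  - by apply: (face_nb xyz); rewrite ?inE ?eqxx ?orbT //; neq.
  by apply: (face_nb xyw); rewrite ?inE ?eqxx ?orbT //; neq.
have nEz : nb z = [set:: [:: v; x; y; w]].
  apply: nb_eq_seq; [uniq_from| |by rewrite light_nb4].
  rewrite /= andbT; repeat (apply/andP; split).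
  - by apply: (face_nb xyz); rewrite ?inE ?eqxx ?orbT //; neq.
  - by apply: (face_nb xyz); rewrite ?inE ?eqxx ?orbT //; neq.
  - by apply: (face_nb xyz); rewrite ?inE ?eqxx ?orbT //; neq.
  by apply: (face_nb vzw); rewrite ?inE ?eqxx ?orbT //; neq.
have ux : uniq [:: v; y; z; w] by uniq_from.
have uz : uniq [:: v; x; y; w] by uniq_from.
have [x2 x3] := lf_nb4 ux nEx; have [z2 z3] := lf_nb4 uz nEz.
have nxzw : face [:: x; z; w] = false.
  move: x2 x3.
  have -> : face [:: x; v; y; z] by face_by xyz.
  have -> : face [:: x; v; y; w] by face_by xyw.
  have -> : face [:: x; v; y] by face_by xyz.
  have -> : face [:: x; v; z] by face_by xyz.
  have -> : face [:: x; v; w] by face_by xyw.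
  have -> : face [:: x; y; z] by face_by xyz.
  have -> : face [:: x; y; w] by face_by xyw.
  move: lx; case: face => //; rewrite /light /typeA /typeB => + E2 E3.
  by rewrite E2 E3; do 2!case: face; case/orP => /and3P[].
have nzxw : face [:: z; x; w] = false by apply: contraFF nxzw => h; face_by h.
move: z2 z3; rewrite nzxw.
have -> : face [:: z; v; x; w] = false by apply: contraFF xzw => h; face_by h.
have -> : face [:: z; v; y; w] = false by apply: contraFF yzw => h; face_by h.
have -> : face [:: z; x; y; w] = false by apply: contraFF nxzw => h; face_by h.
move: lz; rewrite /light /typeA /typeB => + E2 E3; rewrite E2 E3.
by do 6!case: face; case/orP => /and3P[].
Qed.

(** The light neighbours lie all in the shared edge [x y] or all in [z w]. Type (4, 6, 2) is worth
    330, so three payments of 4 would already destroy strictness. *)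
Lemma card_lnb_le2 v x y z w :
  uniq [:: v; x; y; z; w] -> nb v = [set:: [:: x; y; z; w]] ->
  lf 2 v = 6 -> lf 3 v = 2 ->
  face [:: v; x; y; z] -> face [:: v; x; y; w] -> #|lnb v| <= 2.
Proof.
move=> U nE f2 f3 xyz xyw.
have nExw : nb v = [set:: [:: x; y; w; z]] by rewrite nE; set_perm.
have nEy : nb v = [set:: [:: y; x; z; w]] by rewrite nE; set_perm.
have nEyw : nb v = [set:: [:: y; x; w; z]] by rewrite nE; set_perm.
have pair p q : lnb v \subset [set p; q] -> #|lnb v| <= 2.
  by move/subset_leq_card/leq_trans; apply; rewrite cards2; case: (_ != _).
have xz := @nonadjacent_lights v x y z w U nE f2 f3 xyz xyw.
have xw : light x -> ~~ light w.
  by apply: (nonadjacent_lights _ nExw) => //; uniq_from.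
have yz : light y -> ~~ light z.
  by apply: (nonadjacent_lights _ nEy) => //; [uniq_from|face_by xyz|face_by xyw].
have yw : light y -> ~~ light w.
  by apply: (nonadjacent_lights _ nEyw) => //; [uniq_from|face_by xyw|face_by xyz].
have [lx|lx] := boolP (light x); last have [ly|ly] := boolP (light y).
- apply: (pair x y); apply/subsetP => u; rewrite inE nE !inE => /andP[+ lu].
  by case/or4P => /eqP ue; move: lu; rewrite ue ?eqxx ?orbT ?(negPf (xz lx)) ?(negPf (xw lx)).
- apply: (pair x y); apply/subsetP => u; rewrite inE nE !inE => /andP[+ lu].
  by case/or4P => /eqP ue; move: lu; rewrite ue ?eqxx ?orbT ?(negPf (yz ly)) ?(negPf (yw ly)).
apply: (pair z w); apply/subsetP => u; rewrite inE nE !inE => /andP[+ lu].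
by case/or4P => /eqP ue; move: lu; rewrite ue ?eqxx ?orbT ?(negPf lx) ?(negPf ly).
Qed.

Lemma card_setD1 (T : finType) (x : T) (A : {set T}) :
  x \in A -> #|A :\ x| = #|A|.-1.
Proof. by move=> xA; rewrite [in RHS](cardsD1 x A) xA. Qed.

(** A light neighbour [x] has besides [v] three neighbours [M], all adjacent to [v] by type A. If
    some light [e] lies outside [x |: M], it is the fifth neighbour of [v] and also has
    neighbourhood [v |: M]. A light [y] in [M] would then see [x], [e], [v] and the rest of [M],
    five vertices, so only [x] and [e] are light. *)
Lemma lnb_tight v : #|nb v| = 5 -> (forall x, x \in lnb v -> typeA x) ->
  #|lnb v| <= 4 /\
  (#|lnb v| = 4 -> exists2 x, x \in lnb v & lnb v = x |: (nb x :\ v)).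
Proof.
move=> n5 allA.
have [->|/set0Pn[x xl]] := eqVneq (lnb v) set0; first by rewrite cards0.
have Ax := allA x xl; have [/eqP n4 _ _] := and3P Ax.
have xv : x \in nb v by move: xl; rewrite inE => /andP[].
have vx : v \in nb x by rewrite nb_sym.
have nbxx u : u \notin nb u by rewrite inE eqxx.
pose M := nb x :\ v.
have cM : #|M| = 3 by rewrite card_setD1 // n4.
have xM : x \notin M by rewrite !inE eqxx andbF.
have cxM : #|x |: M| = 4 by rewrite cardsU1 xM cM.
have [sub|/subsetPn[e el eM]] := boolP (lnb v \subset x |: M).
  have := subset_leq_card sub; rewrite cxM; split => // c4.
  by exists x => //; apply/eqP; rewrite eqEcard sub cxM c4.
have Ae := allA e el; have [/eqP n4e _ _] := and3P Ae.
have ev : e \in nb v by move: el; rewrite inE => /andP[].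
have ve : v \in nb e by rewrite nb_sym.
have nev : e != v by apply: contraTneq ev => ->.
have [ex enM] : e != x /\ e \notin M by apply/andP; rewrite -negb_or -in_setU1.
have enx : e \notin nb x by apply: contra enM => enx; rewrite in_setD1 nev.
have Mv : M \subset nb v.
  apply/subsetP => y /setD1P[yv yx].
  have := typeA_pair Ax vx yx; rewrite eq_sym => /(_ yv) H.
  by apply: (face_nb H); rewrite ?inE ?eqxx ?orbT.
have nvE : nb v = e |: (x |: M).
  apply/esym/eqP; rewrite eqEcard n5 cardsU1 eM cxM !subUset !sub1set ev xv Mv.
  by [].
have eM' : nb e :\ v = M.
  apply/eqP; rewrite eqEcard cM.
  have -> : #|nb e :\ v| = 3 by rewrite card_setD1 // n4e.
  rewrite andbT; apply/subsetP => y /setD1P[yv ye].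
  have yE : y \in nb v.
    have := typeA_pair Ae ve ye; rewrite eq_sym => /(_ yv) H.
    by apply: (face_nb H); rewrite ?inE ?eqxx ?orbT.
  move: yE; rewrite nvE => /setU1P[yE|/setU1P[yE|//]].
    by case/negP: (nbxx e); rewrite -{1}yE.
  by case/negP: enx; rewrite nb_sym -yE.
have : lnb v \subset [set x; e].
  apply/subsetP => y yl; have Ay := allA y yl; have [/eqP n4y _ _] := and3P Ay.
  have : y \in nb v by move: yl; rewrite inE => /andP[].
  rewrite nvE => /setU1P[->|/setU1P[->|yM]]; rewrite ?inE ?eqxx ?orbT //.
  have yx : y \in nb x by move: yM; rewrite inE => /andP[].
  have ye : y \in nb e by move: yM; rewrite -eM' inE => /andP[].
  have yv : y != v by move: yM; rewrite in_setD1 => /andP[].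
  have sub : x |: (e |: (v |: (M :\ y))) \subset nb y.
    rewrite !subUset !sub1set !(nb_sym _ y) yx ye (subsetP Mv _ yM) /=.
    apply/subsetP => z /setD1P[zy /setD1P[zv zx]].
    have H := typeA_pair Ax yx zx; rewrite eq_sym in zy; have {}H := H zy.
    by apply: (face_nb H); rewrite ?inE ?eqxx ?orbT // eq_sym.
  have := subset_leq_card sub; rewrite n4y.
  have cMy : #|M :\ y| = 2 by rewrite card_setD1 // cM.
  have vM' : v \notin M :\ y by rewrite !inE eqxx andbF.
  have eM2 : e \notin v |: (M :\ y).
    by rewrite in_setU1 (negPf nev) in_setD1 (negPf enM) andbF.
  have xv' : x != v by apply: contraTneq xv => ->.
  have xM2 : x \notin e |: (v |: (M :\ y)).
    by rewrite !in_setU1 eq_sym (negPf ex) (negPf xv') in_setD1 (negPf xM) andbF.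
  by rewrite cardsU1 xM2 cardsU1 eM2 cardsU1 vM' cMy.
move/subset_leq_card; rewrite cards2 => c2.
have {}c2 : #|lnb v| <= 2 by apply: leq_trans c2 _; case: (_ != _).
split; first exact: leq_trans c2 _.
by move=> c4; rewrite c4 in c2.
Qed.

(** A type B neighbour lies in a link triple of [v], hence in [T]. A type A neighbour outside [T]
    would add three pairs at [v] to the three inside [T]. *)
Lemma lnb_sub_triple v T : [set S in link v | #|S| == 3] = [set T] ->
  lf 2 v <= 5 -> lnb v \subset T.
Proof.
move=> TE f2; have : T \in [set S in link v | #|S| == 3] by rewrite TE inE.
rewrite inE => /andP[TL /eqP T3].
apply/subsetP => x; rewrite inE => /andP[xv /orP[Ax|Bx]]; last first.
  have vx : v \in nb x by rewrite nb_sym.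
  have [S [SL S3 xS]] := typeB_nb_face Bx vx.
  have : S \in [set S in link v | #|S| == 3] by rewrite inE SL S3.
  by rewrite TE => /set1P <-.
apply: contraLR f2 => xT; rewrite -ltnNge.
have vx : v \in nb x by rewrite nb_sym.
have [/eqP n4 _ _] := and3P Ax.
pose M := nb x :\ v.
have cM : #|M| = 3 by rewrite card_setD1 // n4.
have xM : x \notin M by rewrite !inE eqxx andbF.
pose E1 := [set [set x; y] | y in M].
pose E2 := [set S : {set V} | S \subset T & #|S| == 2].
have c1 : #|E1| = 3.
  rewrite card_in_imset // => y z yM zM /setP/(_ y).
  rewrite !inE eqxx orbT => /esym/orP[/eqP yx|/eqP //].
  by rewrite -yx yM in xM.
have c2 : #|E2| = 3 by rewrite cards_draws T3.
have E0 : E1 :&: E2 = set0.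
  apply/setP => S; rewrite !inE; apply/negP => /andP[/imsetP[y _ ->]].
  by rewrite subUset !sub1set (negPf xT).
have := cardsUI E1 E2; rewrite E0 cards0 c1 c2 addn0 -[3 + 3]/6 => cU.
rewrite -[5 < _]/(6 <= _) -cU.
apply: subset_leq_card; rewrite subUset; apply/andP; split.
  apply/subsetP => _ /imsetP[y yM ->].
  have [yv yx] := setD1P yM; have H := typeA_pair Ax vx yx.
  rewrite eq_sym in yv; have {}H := H yv.
  have xy : x != y by apply: contraNneq xM => ->.
  rewrite inE cards2 xy andbT -[[set x; y]](_ : [set:: [:: x; y]] = _).
    rewrite link_face !inE negb_or yv andbT; apply/andP; split; last by face_by H.
    by apply: contraTneq vx => ->; rewrite inE eqxx.
  by apply/setP => u; rewrite !inE.
apply/subsetP => S; rewrite 2!inE => /andP[ST ->]; rewrite andbT.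
exact: sub_link TL.
Qed.

(** This is (5, 5, 1), worth 325. Two light neighbours cost at most 3 each. Three fill [T], and then
    none is of type A: a type A vertex [x] of [T] has a neighbour [w] outside, and lightness of the
    rest of [T] forces all six pairs among [T] and [w] into the link of [v]. *)
Lemma outlay_triple v T : [set S in link v | #|S| == 3] = [set T] ->
  lf 2 v = 5 -> #|nb v| = 5 -> outlay v <= 6.
Proof.
move=> TE f2 n5.
have sT : lnb v \subset T by apply: lnb_sub_triple TE _; rewrite f2.
have : T \in [set S in link v | #|S| == 3] by rewrite TE inE.
rewrite inE => /andP[TL /eqP T3].
have f3 : lf 3 v = 1 by rewrite /lf TE cards1.
have pay3 x : pay v x <= 3 by rewrite /pay f3 n5 /=; do 3?case: ifP => _.
have [l2|l3] := leqP #|lnb v| 2.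
  by apply: leq_trans (outlay_le (fun x _ => pay3 x)) _; rewrite -[6]/(3 * 2) leq_mul2l.
have lE : lnb v = T by apply/eqP; rewrite eqEcard sT T3.
suff pay2 x : x \in lnb v -> pay v x <= 2.
  by apply: leq_trans (outlay_le pay2) _; rewrite lE T3.
move=> xl; rewrite /pay f3 n5; case: ifP => // /and3P[_ _ xv].
case: ifP => // Ax; exfalso.
have vx : v \in nb x by rewrite nb_sym.
have [/eqP n4 _ /eqP x3] := and3P Ax.
have xT : x \in T by rewrite -lE.
have /eqP/cards2P[y [z [yz TxE]]] : #|T :\ x| = 2.
  by rewrite card_setD1 // T3.
have TsE : T = [set:: [:: x; y; z]].
  rewrite -(setD1K xT) TxE; apply/setP => u; rewrite !inE.
  by do 3!case: (u == _).
have uT : uniq [:: x; y; z].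
  have : y \in T :\ x by rewrite TxE !inE eqxx.
  have : z \in T :\ x by rewrite TxE !inE eqxx orbT.
  move=> /setD1P[zx _] /setD1P[yx _].
  by rewrite /= !inE negb_or eq_sym yx eq_sym zx yz.
move: TL; rewrite TsE link_face => /andP[vT fT].
have Uv : uniq [:: v; x; y; z] by rewrite cons_uniq vT.
have [||w [U nEx]] := @nb_extend x v y z n4.
- by clear uT; uniq_from.
- rewrite /= vx /= andbT; apply/andP; split.
    by apply: (face_nb fT); rewrite ?inE ?eqxx ?orbT //; neq.
  by apply: (face_nb fT); rewrite ?inE ?eqxx ?orbT //; neq.
clear Uv uT.
have ux : uniq [:: v; y; z; w] by move: U; rewrite cons_uniq => /andP[].
have P p q : p \in [:: v; y; z; w] -> q \in [:: v; y; z; w] -> p != q ->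
    face [:: x; p; q].
  by move=> pn qn; apply: typeA_pair => //; rewrite nEx in_set.
have ly : light y by have : y \in lnb v; [rewrite lE TsE !inE eqxx orbT|rewrite inE => /andP[]].
have lz : light z by have : z \in lnb v; [rewrite lE TsE !inE eqxx !orbT|rewrite inE => /andP[]].
have [_] := lf_nb4 ux nEx; rewrite x3.
have -> : face [:: x; v; y; z] by face_by fT.
case xvyw: (face [:: x; v; y; w]); first by do 2!case: face.
case xvzw: (face [:: x; v; z; w]); first by case: face.
case xyzw: (face [:: x; y; z; w]) => // _.
have xvw : face [:: x; v; w] by apply: P; rewrite ?inE ?eqxx ?orbT //; clear ux; neq.
have xyw : face [:: x; y; w] by apply: P; rewrite ?inE ?eqxx ?orbT //; clear ux; neq.
have xzw : face [:: x; z; w] by apply: P; rewrite ?inE ?eqxx ?orbT //; clear ux; neq.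
clear ux.
(* If [p] is of type A, every pair at [p] is a face, in particular [v w]. If it is of type B, its
   second triple can only be [v q w], which contains that pair. *)
have third p q : uniq [:: x; v; p; q; w] -> light p ->
    face [:: v; x; p; q] -> face [:: x; p; w] -> 
    face [:: x; v; p; w] = false -> face [:: x; p; q; w] = false ->
    face [:: v; p; w].
  clear U => U lp fvxpq fxpw nxvpw nxpqw.
  have nEp : nb p = [set:: [:: x; v; q; w]].
    apply: nb_eq_seq; [uniq_from| |by rewrite light_nb4].
    rewrite /= andbT; repeat (apply/andP; split).
    - by apply: (face_nb fvxpq); rewrite ?inE ?eqxx ?orbT //; neq.
    - by apply: (face_nb fvxpq); rewrite ?inE ?eqxx ?orbT //; neq.
    - by apply: (face_nb fvxpq); rewrite ?inE ?eqxx ?orbT //; neq.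
    by apply: (face_nb fxpw); rewrite ?inE ?eqxx ?orbT //; neq.
  have wp : w \in nb p by rewrite nEp !inE eqxx !orbT.
  have vp : v \in nb p by rewrite nEp !inE eqxx !orbT.
  have vw : v != w by neq.
  case/orP: lp => [Ap|/and3P[_ _ /eqP p3]].
    by have H := typeA_pair Ap vp wp vw; face_by H.
  have up : uniq [:: x; v; q; w] by uniq_from.
  have [_] := lf_nb4 up nEp; rewrite p3.
  have -> : face [:: p; x; v; w] = false by apply: contraFF nxvpw => h; face_by h.
  have -> : face [:: p; x; q; w] = false by apply: contraFF nxpqw => h; face_by h.
  case H: (face [:: p; v; q; w]); last by case: face.
  by move=> _; face_by H.
have vyw : face [:: v; y; w] by apply: (third y z).
have vzw : face [:: v; z; w].
  apply: (third z y) => //; first uniq_from; first by face_by fT.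
  by apply: contraFF xyzw => h; face_by h.
have Uv : uniq [:: v; x; y; z; w] by uniq_from.
have := lf2_ge4 Uv; rewrite f2.
have -> : face [:: v; x; y] by face_by fT.
have -> : face [:: v; x; z] by face_by fT.
have -> : face [:: v; x; w] by face_by xvw.
have -> : face [:: v; y; z] by face_by fT.
by rewrite vyw vzw.
Qed.

Lemma lf2_le6 v : #|nb v| = 4 -> lf 2 v <= 6.
Proof.
move=> n4; have <- : 'C(#|nb v|, 2) = 6 by rewrite n4.
rewrite -cards_draws; apply: subset_leq_card; apply/subsetP => S.
by rewrite 2!inE => /andP[/link_nb-> ->].
Qed.

Lemma nb4_seq v : #|nb v| = 4 ->
  exists a b c d, uniq [:: v; a; b; c; d] /\ nb v = [set:: [:: a; b; c; d]].
Proof.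
move=> n4; have := enum_uniq (nb v); have := cardE (nb v); rewrite n4.
have eE : [set:: enum (nb v)] = nb v by apply/setP => u; rewrite inE mem_enum.
case E: (enum (nb v)) => [|a [|b [|c [|d [|]]]]] // _ us.
exists a, b, c, d; rewrite -eE E cons_uniq us andbT; split => //.
by rewrite -E mem_enum inE eqxx.
Qed.

(** Three of the four triples on four points cover all six pairs, so f2 < 6 would force (5, 2),
    which is type B; and (6, 1) is type A. *)
Lemma nb4_bounds v : ~~ light v -> #|nb v| = 4 -> 12 <= 5 + lf 2 v + lf 3 v ->
  lf 2 v = 6 /\ (2 < lf 3 v \/ lf 3 v = 2 /\ #|lnb v| <= 2).
Proof.
move=> hv n4 dv; have f26 := lf2_le6 n4.
have [a [b [c [d [U nE]]]]] := nb4_seq n4.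
have u4 : uniq [:: a; b; c; d] by move: U; rewrite cons_uniq => /andP[].
have [E2 E3] := lf_nb4 u4 nE.
have f2 : lf 2 v = 6.
  have [f33|f33] := leqP (lf 3 v) 2.
    apply/eqP; rewrite eqn_leq f26 /= leqNgt; apply/negP => f25.
    case/negP: hv; rewrite /light /typeB n4.
    have [-> ->] : lf 2 v = 5 /\ lf 3 v = 2.
      by move: dv f33 f25; move: (lf 2 v) (lf 3 v); clear; lia.
    by rewrite orbT.
  rewrite E2; move: f33; rewrite E3.
  case ab: (face [:: v; a; b]); last first.
    have -> : face [:: v; a; b; c] = false by apply: contraFF ab => h; face_by h.
    have -> : face [:: v; a; b; d] = false by apply: contraFF ab => h; face_by h.
    by do 2!case: face.
  case ac: (face [:: v; a; c]); last first.
    have -> : face [:: v; a; b; c] = false by apply: contraFF ac => h; face_by h.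
    have -> : face [:: v; a; c; d] = false by apply: contraFF ac => h; face_by h.
    by do 2!case: face.
  case ad: (face [:: v; a; d]); last first.
    have -> : face [:: v; a; b; d] = false by apply: contraFF ad => h; face_by h.
    have -> : face [:: v; a; c; d] = false by apply: contraFF ad => h; face_by h.
    by do 2!case: face.
  case bc: (face [:: v; b; c]); last first.
    have -> : face [:: v; a; b; c] = false by apply: contraFF bc => h; face_by h.
    have -> : face [:: v; b; c; d] = false by apply: contraFF bc => h; face_by h.
    by do 2!case: face.
  case bd: (face [:: v; b; d]); last first.
    have -> : face [:: v; a; b; d] = false by apply: contraFF bd => h; face_by h.
    have -> : face [:: v; b; c; d] = false by apply: contraFF bd => h; face_by h.
    by do 2!case: face.
  case cd: (face [:: v; c; d]) => //.
  have -> : face [:: v; a; c; d] = false by apply: contraFF cd => h; face_by h.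
  have -> : face [:: v; b; c; d] = false by apply: contraFF cd => h; face_by h.
  by do 2!case: face.
split => //; have [f33|f33] := ltnP 2 (lf 3 v); [by left|right].
have f3 : lf 3 v = 2.
  have f3n : lf 3 v <> 1.
    by move=> f3; case/negP: hv; rewrite /light /typeA n4 f2 f3.
  by move: dv f33 f3n; rewrite f2; move: (lf 3 v); clear; lia.
split => //; have le2 := @card_lnb_le2 v.
move: E3; rewrite f3; clear u4.
(* Any two of the four triples share a pair, which takes the role of [p q]; this accounts for the
   six cases below. *)
have fin p q r (w : V) : nb v = [set:: [:: p; q; r; w]] -> uniq [:: v; p; q; r; w] ->
  face [:: v; p; q; r] -> face [:: v; p; q; w] -> #|lnb v| <= 2.
  by move=> h1 h2 h3 h4; apply: (le2 p q r w).
case abc: (face [:: v; a; b; c]); case abd: (face [:: v; a; b; d]);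
  case acd: (face [:: v; a; c; d]); case bcd: (face [:: v; b; c; d]) => // _.
- by apply: (fin a b c d).
- by apply: (fin a c b d); [rewrite nE; set_perm|uniq_from|face_by abc|face_by acd].
- by apply: (fin b c a d); [rewrite nE; set_perm|uniq_from|face_by abc|face_by bcd].
- by apply: (fin a d b c); [rewrite nE; set_perm|uniq_from|face_by abd|face_by acd].
- by apply: (fin b d a c); [rewrite nE; set_perm|uniq_from|face_by abd|face_by bcd].
by apply: (fin c d a b); [rewrite nE; set_perm|uniq_from|face_by acd|face_by bcd].
Qed.

(** The heavy vertices whose surplus is used up: 330 = 318 + 4 * 3. *)
Definition tight v := [&& #|nb v| == 5, lf 2 v == 6, lf 3 v == 0 & #|lnb v| == 4].

Lemma heavy_bound v : ~~ light v ->
  318 + outlay v < weight v \/ tight v /\ 318 + outlay v <= weight v.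
Proof.
move=> hv; have k4 := card_nb_gt3 v; have dv := card_link_ge v.
have o4 : outlay v <= 4 * #|lnb v| by apply: outlay_le => x _; apply: pay_le4.
have lk := subset_leq_card (lnb_sub v).
case: (big_face_or_count v) => [[S SL S4]|cE].
  (* Six pairs and four triples give at least 240 + 30k, against 318 + 4k with k at least 4. *)
  left; have := lf_ge_bin 2 SL; have := lf_ge_bin 3 SL.
  rewrite S4 /weight (_ : 'C(4, 2) = 6) // (_ : 'C(4, 3) = 4) //.
  move: #|nb v| (lf 2 v) (lf 3 v) (outlay v) #|lnb v| k4 o4 lk.
  by clear; lia.
rewrite {}cE in dv.
have [k5|k5] := leqP #|nb v| 4.
  have n4 : #|nb v| = 4 by apply/eqP; rewrite eqn_leq k5.
  left; have [|f2 f3] := nb4_bounds hv n4; first by rewrite n4 in dv.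
  rewrite /weight n4 f2; rewrite n4 in lk.
  move: (lf 3 v) (outlay v) #|lnb v| f3 o4 lk; clear => p q r; lia.
have [f31|f31] := ltnP 1 (lf 3 v).
  left; have := lf3_gt1 f31; rewrite /weight.
  move: #|nb v| (lf 2 v) (lf 3 v) (outlay v) #|lnb v| k5 f31 o4 lk.
  by clear; lia.
have [f30|f30] := posnP (lf 3 v).
  have allA x : x \in lnb v -> typeA x.
    rewrite inE => /andP[xv /orP[//|Bx]].
    have vx : v \in nb x by rewrite nb_sym.
    by have := typeB_nb_lf3 Bx vx; rewrite f30.
  have o3 : outlay v <= 3 * #|lnb v|.
    apply: outlay_le => x /allA Ax; rewrite /pay Ax; by case: ifP.
  have [k6|k6] := ltnP 5 #|nb v|.
    (* Here f2 >= 11 - k, so the weight is at least 280 + 10k, more than 318 + 3k once k >= 6. *)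
    left; rewrite /weight f30; rewrite f30 in dv.
    move: #|nb v| (lf 2 v) (outlay v) #|lnb v| k6 dv o3 lk.
    by clear; lia.
  have n5 : #|nb v| = 5 by apply/eqP; rewrite eqn_leq k6.
  have [l4 _] := lnb_tight n5 allA.
  rewrite /tight /weight f30 n5; rewrite f30 n5 in dv.
  have [f27|f27] := ltnP 6 (lf 2 v).
    by left; move: (lf 2 v) (outlay v) #|lnb v| f27 o3 l4; clear; lia.
  have f26 : lf 2 v = 6 by move: dv f27; clear; lia.
  rewrite f26; have [l3|l3] := leqP #|lnb v| 3.
    by left; move: (outlay v) #|lnb v| l3 o3; clear; lia.
  right; have -> : #|lnb v| = 4 by apply/eqP; rewrite eqn_leq l4.
  by split => //; move: (outlay v) #|lnb v| l4 o3; clear; lia.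
have f3 : lf 3 v = 1 by apply/eqP; rewrite eqn_leq f31.
left; have [f26|f26] := ltnP 5 (lf 2 v).
  rewrite /weight f3; move: #|nb v| (lf 2 v) (outlay v) #|lnb v| k5 f26 o4 lk.
  by clear; lia.
have /eqP/cards1P[T TE] := f3.
have T3 : #|T| = 3.
  have : T \in [set S in link v | #|S| == 3] by rewrite TE inE.
  by rewrite inE => /andP[_ /eqP].
have := subset_leq_card (lnb_sub_triple TE f26); rewrite T3 => l3.
have f23 : 3 <= lf 2 v.
  have TL : T \in link v.
    have : T \in [set S in link v | #|S| == 3] by rewrite TE inE.
    by rewrite inE => /andP[].
  by have := lf_ge_bin 2 TL; rewrite T3.
rewrite f3 in dv; have [k6|k6] := ltnP 5 #|nb v|.
  (* At k = 6 the degree bound gives f2 >= 4, hence 335 against 318 + 12; from k = 7 on, the three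
     pairs inside [T] are enough. *)
  rewrite /weight f3.
  move: #|nb v| (lf 2 v) (outlay v) #|lnb v| k6 f23 dv o4 l3.
  by clear; lia.
have n5 : #|nb v| = 5 by apply/eqP; rewrite eqn_leq k6.
rewrite n5 in dv; have f25 : lf 2 v = 5 by move: dv f26; clear; lia.
by have := outlay_triple TE f25 n5; rewrite /weight n5 f25 f3; clear; lia.
Qed.

(** * The case of equality *)

Lemma light_outlay v : light v -> outlay v = 0.
Proof. by move=> lv; apply: big1 => x _; rewrite /pay lv. Qed.

Lemma discharge v : 318 + outlay v <= weight v + income v.
Proof.
have [lv|hv] := boolP (light v); last first.
  apply: leq_trans (leq_addr _ _).
  by case: (heavy_bound hv) => [/ltnW|[]].
rewrite light_outlay // addn0 /weight.
case/orP: lv => [Av|Bv].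
  have [/eqP-> /eqP-> /eqP->] := and3P Av.
  by rewrite -[X in X <= _]/(315 + 3) leq_add2l income_typeA.
have [/eqP-> /eqP-> /eqP->] := and3P Bv.
by rewrite -[X in X <= _]/(310 + 8) leq_add2l income_typeB.
Qed.

(** In the sum over all vertices payments cancel, so the total weight is at least 318 n, while 60
    (|F| - 1) bounds it above by 318 n. Equality of the sums forces equality at each vertex. *)
Lemma discharge_eq : 0 < #|V| -> 10 * #|F| <= 53 * #|V| + 10 ->
  10 * #|F| = 53 * #|V| + 10 /\
  forall v, 318 + outlay v = weight v + income v.
Proof.
move=> V0 Fle.
have sumD (g h : V -> nat) : \sum_v (g v + h v) = \sum_v g v + \sum_v h v.
  by rewrite big_split.
have inout : \sum_v income v = \sum_v outlay v by rewrite /income exchange_big.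
have := sum_weight.
have [le_s eq_s] := leqif_sum (fun v (_ : true) => leqif_eq (discharge v)).
move: le_s eq_s; rewrite (sumD (fun=> 318) outlay) (sumD weight income) inout.
have -> : \sum_(v : V) 318 = 318 * #|V| by rewrite sum_nat_const mulnC.
move: (\sum_v outlay v) (\sum_v weight v) => o w le_s eq_s le_w.
have wE : w = 318 * #|V|.
  by move: le_s le_w Fle; move: #|F| #|V|; clear; lia.
split.
  by move: V0 Fle le_w; rewrite wE; move: #|F| #|V|; clear; lia.
move: eq_s; rewrite wE eqxx => /esym/forall_inP H v.
by apply/eqP/H.
Qed.

(** Heavy vertices are now tight with f3 = 0, whereas every neighbour of a type B vertex has f3 > 0;
    such a vertex would have no income at all. *)
Lemma extremal_types : 0 < #|V| -> 10 * #|F| <= 53 * #|V| + 10 ->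
  forall v, if light v then typeA v else tight v.
Proof.
move=> V0 Fle; have [_ E] := discharge_eq V0 Fle.
have T v : ~~ light v -> tight v.
  move=> hv; case: (heavy_bound hv) => [lt|[]//].
  by have := leq_trans lt (leq_addr (income v) _); rewrite -E ltnn.
move=> v; case: ifPn => [lv|/T //]; case/orP: (lv) => // Bv.
have := income_typeB Bv; rewrite leqNgt /income big1 // => u _.
rewrite /pay; case: and3P => // -[/T/and4P[_ _ f3 _] _ vu].
by have := @typeB_nb_lf3 v u Bv; rewrite nb_sym vu (eqP f3) => /(_ isT).
Qed.

(** * Blocks and the pairing of heavy vertices *)

Section Extremal.

Hypothesis types : forall v, if light v then typeA v else tight v.

Lemma light_typeA v : light v -> typeA v.
Proof. by have := types v; case: ifP. Qed.

Lemma heavy_tight v : ~~ light v -> tight v.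
Proof. by have := types v; case: ifP. Qed.

(** For heavy [v] this becomes a set U_i, with [v] as its last element 5i. *)
Definition block v := v |: lnb v.

Lemma lnb_irrefl v : v \notin lnb v.
Proof. by rewrite !inE eqxx. Qed.

Lemma card_lnb v : ~~ light v -> #|lnb v| = 4.
Proof. by case/heavy_tight/and4P => _ _ _ /eqP. Qed.

Lemma heavy_lf3 v : ~~ light v -> lf 3 v = 0.
Proof. by case/heavy_tight/and4P => _ _ /eqP. Qed.

Lemma blockD1 v : block v :\ v = lnb v.
Proof. by rewrite setU1K ?lnb_irrefl. Qed.

(** By the equality case of [lnb_tight] the block is some type A vertex [x] with its neighbours, so
    any two of its vertices are adjacent; four neighbours leave no room outside. *)
Lemma lnb_nb v y : ~~ light v -> y \in lnb v -> nb y = block v :\ y.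
Proof.
move=> hv; have /and4P[/eqP n5 _ _ /eqP l4] := heavy_tight hv.
have allA x : x \in lnb v -> typeA x by rewrite inE => /andP[_ /light_typeA].
have [_ /(_ l4)[x xl lE]] := lnb_tight n5 allA.
have Ax := allA x xl.
have vx : v \in nb x by rewrite nb_sym; move: xl; rewrite inE => /andP[].
have xx : x \notin nb x by rewrite inE eqxx.
have bE : block v = x |: nb x by rewrite /block lE setUCA setD1K.
rewrite bE {1}lE => /setU1P[->|/setD1P[yv yx]]; first by rewrite setU1K.
have yl : y \in lnb v by rewrite lE !inE yv; move: yx; rewrite inE => ->; rewrite orbT.
have Ay := allA y yl; have /and3P[/eqP ny _ _] := Ay; have /and3P[/eqP nx _ _] := Ax.
apply/esym/eqP; rewrite eqEcard card_setD1; last by rewrite inE yx orbT.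
rewrite cardsU1 xx nx ny andbT; apply/subsetP => z /setD1P[zy].
case/setU1P => [->|zx]; first by rewrite nb_sym.
have H := typeA_pair Ax yx zx; rewrite eq_sym in zy; have {}H := H zy.
by apply: (face_nb H); rewrite ?inE ?eqxx ?orbT // eq_sym.
Qed.

(** The unique heavy neighbour, the default never being taken. For light [y] it is the heavy vertex
    of the block of [y], for heavy [y] that of the partner block. *)
Definition hnb y := odflt y [pick u in nb y | ~~ light u].

Lemma hnb_ex y : exists2 u, (u \in nb y) && ~~ light u &
  forall w, w \in nb y -> ~~ light w -> w = u.
Proof.
have [ly|hy] := boolP (light y).
  have [u uy hu] := typeA_has_heavy (light_typeA ly).
  exists u; first by rewrite uy hu.
  move=> w wy hw; have yl : y \in lnb u by rewrite inE ly nb_sym uy.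
  move: wy; rewrite (lnb_nb hu yl) => /setD1P[_ /setU1P[//|]].
  by rewrite inE (negPf hw) andbF.
have /and4P[/eqP n5 _ _ /eqP l4] := heavy_tight hy.
have /eqP/cards1P[u uE] : #|nb y :\: lnb y| = 1.
  by rewrite cardsD (setIidPr (lnb_sub y)) n5 l4.
exists u.
  have : u \in nb y :\: lnb y by rewrite uE inE.
  by rewrite in_setD inE negb_and => /andP[/orP[/negPf->//|->] ->].
move=> w wy hw; apply/set1P; rewrite -uE in_setD wy andbT.
by rewrite inE (negPf hw) andbF.
Qed.

Lemma hnbP y : hnb y \in nb y /\ ~~ light (hnb y).
Proof.
rewrite /hnb; case: pickP => [u /andP[]//|none].
by have [u uy _] := hnb_ex y; have := none u; rewrite uy.
Qed.

Lemma hnb_uniq y w : w \in nb y -> ~~ light w -> w = hnb y.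
Proof.
have [h1 h2] := hnbP y; have [u _ H] := hnb_ex y => wy hw.
by rewrite (H _ wy hw) (H _ h1 h2).
Qed.

Lemma hnbK v : ~~ light v -> hnb (hnb v) = v.
Proof.
by move=> hv; apply/esym/hnb_uniq => //; rewrite nb_sym; case: (hnbP v).
Qed.

Definition home y := if light y then hnb y else y.

Lemma home_heavy y : ~~ light (home y).
Proof. by rewrite /home; case: ifPn => // _; case: (hnbP y). Qed.

Lemma mem_home y : y \in block (home y).
Proof.
rewrite /home; case: ifP => ly; last by rewrite setU11.
by rewrite setU1r // inE ly andbT nb_sym; case: (hnbP y).
Qed.

Lemma mem_block v y : ~~ light v -> (y \in block v) = (home y == v).
Proof.
move=> hv; apply/idP/eqP => [|<-]; last exact: mem_home.
rewrite /home => /setU1P[->|]; first by rewrite (negPf hv).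
by rewrite inE => /andP[yv ->]; apply/esym/hnb_uniq; rewrite // nb_sym.
Qed.

Lemma typeA_link y S : typeA y -> S \subset nb y -> #|S| <= 2 -> S \in link y.
Proof.
move=> Ay Sn S2; have yS : y \notin S.
  by apply/negP => /(subsetP Sn); rewrite inE eqxx.
rewrite inE yS; case E: #|S| S2 => [|[|[|]]] // _.
- by rewrite (cards0_eq E) setU0 -set_seq1 -/(face [:: y]) face1.
- have /eqP/cards1P[z SE] := E; move: Sn; rewrite SE sub1set inE => /andP[_].
  by rewrite /face set_cons set_seq1.
have /eqP/cards2P[z [w [zw SE]]] := E; rewrite SE.
move: Sn; rewrite SE subUset !sub1set => /andP[zn wn].
by have := typeA_pair Ay zn wn zw; rewrite /face !set_cons set_nil setU0.
Qed.

Lemma link_size3 v S : ~~ light v -> v \notin S -> v |: S \in F -> #|S| != 3.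
Proof.
move=> hv vS SF; apply/negP => S3.
have : 0 < lf 3 v by apply/card_gt0P; exists S; rewrite !inE vS SF.
by rewrite heavy_lf3.
Qed.

(** The face stays in the block because the neighbours of [y] do, and it avoids the heavy vertex,
    whose f3 is 0; only four vertices remain. *)
Lemma light_facet y S : light y -> S \in link y -> #|S| = 3 ->
  y |: S = lnb (home y).
Proof.
move=> ly SL S3; have hv := home_heavy y; set v := home y in hv *.
have yl : y \in lnb v.
  have := mem_home y; rewrite -/v => /setU1P[yv|//].
  by move: hv; rewrite -yv ly.
have [yS SF] : y \notin S /\ y |: S \in F by move: SL; rewrite inE => /andP[].
have Sb : y |: S \subset block v.
  rewrite subUset sub1set mem_home /=.
  by apply: subset_trans (link_nb SL) _; rewrite (lnb_nb hv yl) subsetDl.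
have vyS : v \notin y |: S.
  apply/negP => vyS; have := @link_size3 v ((y |: S) :\ v) hv.
  by rewrite setD1K // !inE eqxx card_setD1 // cardsU1 yS S3 => /(_ isT SF).
apply/eqP; rewrite eqEcard cardsU1 yS S3 card_lnb // andbT -blockD1.
by rewrite subsetD1 Sb vyS.
Qed.

(** The three cases are the families G, H and I for d = 5. A face with a light vertex stays in one
    block; a face of heavy vertices only has at most two, as the heavy neighbour is unique. *)
Lemma extremal_mem A : (exists x : V, true) ->
  A \in F <-> exists2 v, ~~ light v &
    [\/ (A \subset block v) && (#|A| <= 3), A = lnb v | A = [set v; hnb v]].
Proof.
case=> x0 _; split=> [AF|[v hv [/andP[Ab A3]|->|->]]].
- have [/exists_inP[y yA ly]|] := boolP [exists y in A, light y].
    exists (home y); first exact: home_heavy.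
    have hv := home_heavy y; set v := home y in hv *.
    have yl : y \in lnb v.
      have := mem_home y; rewrite -/v => /setU1P[yv|//].
      by move: hv; rewrite -yv ly.
    have SL : A :\ y \in link y by rewrite !inE eqxx /= setD1K.
    have /and3P[_ _ /eqP f3] := light_typeA ly.
    have A4 : #|A :\ y| <= 3.
      rewrite leqNgt; apply/negP => S4.
      have := lf_ge_bin 3 SL; rewrite f3 leqNgt => /negP; apply.
      by apply: leq_trans (leq_bin2l 3 S4).
    have [S3|S2] := eqVneq #|A :\ y| 3.
      by constructor 2; rewrite -(setD1K yA) (light_facet ly SL S3).
    constructor 1; apply/andP; split.
      rewrite -(setD1K yA) subUset sub1set mem_home.
      by apply: subset_trans (link_nb SL) _; rewrite (lnb_nb hv yl) subsetDl.
    by rewrite (cardsD1 y) yA ltn_neqAle S2.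
  rewrite negb_exists_in => /forall_inP hA.
  have [A0|/set0Pn[v vA]] := eqVneq A set0.
    (* The empty face belongs to every block; [x0] serves to name one. *)
    exists (home x0); first exact: home_heavy.
    by constructor 1; rewrite A0 sub0set cards0.
  exists v; first exact: hA.
  have SL : A :\ v \in link v by rewrite !inE eqxx /= setD1K.
  have sub : A :\ v \subset [set hnb v].
    apply/subsetP => w wA; rewrite inE; apply/eqP/hnb_uniq.
      exact: subsetP (link_nb SL) _ wA.
    by apply: hA; move: wA; rewrite inE => /andP[].
  move: sub; rewrite subset1 => /orP[]/eqP AE.
    by constructor 3; rewrite -(setD1K vA) AE.
  constructor 1; rewrite -(setD1K vA) AE setU0 cards1 andbT.
  by rewrite sub1set setU11.
- have [/exists_inP[y yA ly]|] := boolP [exists y in A, light y].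
    have yb := subsetP Ab _ yA; have yv : y != v.
      by apply: contraTneq ly => ->.
    have yl : y \in lnb v by move: yb; rewrite in_setU1 (negPf yv).
    have : A :\ y \in link y.
      apply: typeA_link; first exact: light_typeA.
        by rewrite (lnb_nb hv yl) setSD.
      by rewrite card_setD1 //; case: #|A| A3 => [|[|[|[|]]]].
    by rewrite inE setD1K // => /andP[].
  rewrite negb_exists_in => /forall_inP hA.
  apply: (herF (A := [set v])); last by rewrite -set_seq1 -/(face [:: v]) face1.
  apply/subsetP => y yA; have := subsetP Ab _ yA.
  by case/setU1P => [->|]; rewrite ?set11 // in_set (negPf (hA _ yA)) andbF.
- have /card_gt0P[y yl] : 0 < #|lnb v| by rewrite card_lnb.
  have ly : light y by move: yl; rewrite inE => /andP[].
  have /and3P[_ _ /eqP f3] := light_typeA ly.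
  have /card_gt0P[S] : 0 < lf 3 y by rewrite f3.
  rewrite inE => /andP[SL /eqP S3].
  have <- : home y = v by apply/eqP; rewrite -mem_block // setU1r.
  by rewrite -(light_facet ly SL S3); move: SL; rewrite inE => /andP[].
have [+ _] := hnbP v; rewrite inE => /andP[_].
by rewrite /face !set_cons set_nil setU0.
Qed.

(** * Numbering the vertices as in the extremal family *)

Variable x0 : V.

(** One heavy vertex from each pair: on heavy vertices [hnb] is an involution without fixed points,
    and [enum_rank] breaks the tie. *)
Definition reps :=
  enum [set v | ~~ light v & enum_rank v < enum_rank (hnb v)].

Lemma mem_reps v :
  (v \in reps) = ~~ light v && (enum_rank v < enum_rank (hnb v)).
Proof. by rewrite mem_enum inE. Qed.

Lemma hnb_reps v : ~~ light v -> (hnb v \in reps) = (v \notin reps).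
Proof.
move=> hv; have [vn hn] := hnbP v.
rewrite !mem_reps hv hn hnbK //= -leqNgt ltn_neqAle.
suff -> : enum_rank (hnb v) != enum_rank v :> nat by [].
rewrite (inj_eq val_inj) (inj_eq enum_rank_inj).
by move: vn; rewrite inE => /andP[].
Qed.

(* Paired blocks get consecutive ranks [2j] and [2j+1], as in [F0]; within the
   block of rank [i], the heavy vertex gets the last code [5i+4]. *)
Definition rk v :=
  if v \in reps then (index v reps).*2 else (index (hnb v) reps).*2.+1.

Definition unrk i :=
  let w := nth x0 reps i./2 in if odd i then hnb w else w.

Lemma rk_lt v : ~~ light v -> rk v < (size reps).*2.
Proof.
move=> hv; rewrite /rk; case: ifPn => vr; first by rewrite ltn_double index_mem.
by rewrite -doubleS leq_double index_mem hnb_reps.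
Qed.

Lemma rkK v : ~~ light v -> unrk (rk v) = v.
Proof.
move=> hv; rewrite /rk /unrk; have [vr|vr] := boolP (v \in reps).
  by rewrite odd_double doubleK nth_index.
rewrite oddS odd_double -[_.*2.+1./2]/(uphalf _) uphalf_double.
by rewrite nth_index ?hnb_reps //= hnbK.
Qed.

Lemma unrk_nth i : i < (size reps).*2 -> nth x0 reps i./2 \in reps.
Proof. by move=> im; rewrite mem_nth // ltn_half_double. Qed.

Lemma unrk_heavy i : i < (size reps).*2 -> ~~ light (unrk i).
Proof.
move=> /unrk_nth; rewrite /unrk mem_reps => /andP[h _].
by case: ifP => // _; case: (hnbP (nth x0 reps i./2)).
Qed.

Lemma unrkK i : i < (size reps).*2 -> rk (unrk i) = i.
Proof.
move=> im; have wr := unrk_nth im; have := wr.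
rewrite mem_reps => /andP[hw _].
have idx : index (nth x0 reps i./2) reps = i./2.
  by rewrite index_uniq ?enum_uniq // ltn_half_double.
have io := odd_double_half i; rewrite /unrk /rk; case oi: (odd i).
  by rewrite hnb_reps // wr /= hnbK // idx -[RHS]io oi.
by rewrite wr idx -[RHS]io oi.
Qed.

Lemma rk_hnb v : ~~ light v -> ~~ odd (rk v) -> rk (hnb v) = (rk v).+1.
Proof.
move=> hv; rewrite /rk hnb_reps //; case: ifPn => vr /=.
  by rewrite hnbK.
by rewrite odd_double.
Qed.

Lemma odd_rk_hnb v : ~~ light v -> odd (rk v) -> ~~ odd (rk (hnb v)).
Proof.
by move=> hv; rewrite /rk hnb_reps //; case: ifPn; rewrite /= ?odd_double.
Qed.

Definition pos y := if light y then index y (enum (lnb (home y))) else 4.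

Definition code y := 5 * rk (home y) + pos y.

Definition decode k :=
  let v := unrk (k %/ 5) in
  if k %% 5 == 4 then v else nth v (enum (lnb v)) (k %% 5).

Lemma light_lnb_home y : light y -> y \in lnb (home y).
Proof.
move=> ly; have := mem_home y; rewrite in_setU1 => /orP[/eqP yh|//].
by have := home_heavy y; rewrite -yh ly.
Qed.

Lemma pos_light y : light y -> pos y < 4.
Proof.
move=> ly; rewrite /pos ly -[X in _ < X](card_lnb (home_heavy y)).
by rewrite cardE index_mem mem_enum light_lnb_home.
Qed.

Lemma pos_lt5 y : pos y < 5.
Proof. by have [/pos_light/ltnW//|hy] := boolP (light y); rewrite /pos (negPf hy). Qed.

Lemma code_div y : code y %/ 5 = rk (home y).
Proof. by rewrite /code mulnC divnMDl // divn_small ?addn0 ?pos_lt5. Qed.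

Lemma code_mod y : code y %% 5 = pos y.
Proof. by rewrite /code mulnC modnMDl modn_small ?pos_lt5. Qed.

Lemma codeK : cancel code decode.
Proof.
move=> y; rewrite /decode code_div code_mod rkK ?home_heavy //.
have [ly|hy] := boolP (light y); last by rewrite /pos (negPf hy) /home (negPf hy).
have := pos_light ly; rewrite ltn_neqAle => /andP[/negPf-> _].
by rewrite /pos ly nth_index // mem_enum light_lnb_home.
Qed.

Lemma code_lt y : code y < 10 * size reps.
Proof.
have := rk_lt (home_heavy y); have := pos_lt5 y; rewrite /code.
by move: (rk _) (pos y) (size reps) => r p m; clear; lia.
Qed.

Lemma decodeK k : k < 10 * size reps -> code (decode k) = k.
Proof.
move=> km; have im : k %/ 5 < (size reps).*2.
  by rewrite ltn_divLR // -muln2 -mulnA mulnC.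
have hv := unrk_heavy im; have kE := divn_eq k 5.
rewrite /decode; set v := unrk (k %/ 5) in hv *.
have [k4|k4] := eqVneq (k %% 5) 4.
  by rewrite /code /pos /home (negPf hv) unrkK // [RHS]kE k4 mulnC.
have k5 : k %% 5 < size (enum (lnb v)).
  by rewrite -cardE card_lnb // ltn_neqAle k4 -ltnS ltn_pmod.
have yl : nth v (enum (lnb v)) (k %% 5) \in lnb v by rewrite -mem_enum mem_nth.
have ly := yl; rewrite in_set in ly; case/andP: ly => _ ly.
have yh : home (nth v (enum (lnb v)) (k %% 5)) = v.
  by apply/eqP; rewrite -mem_block // setU1r.
by rewrite /code /pos ly yh unrkK // index_uniq ?enum_uniq // [RHS]kE mulnC.
Qed.

(** Here m counts the pairs of blocks. Each pair has ten vertices, so divisibility of n by 10 comes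
    with the bijection. *)
Lemma extremal_iso : exists m, exists f : V -> 'I_(10 * m),
  bijective f /\ [set f @: A | A : {set V} in F] = F0 (10 * m) 5.
Proof.
exists (size reps); set m := size reps.
pose f y := Ordinal (code_lt y); exists f.
pose g (k : 'I_(10 * m)) := decode k.
have fK : cancel f g by move=> y; apply: codeK.
have gK : cancel g f by move=> k; apply: val_inj; apply: decodeK.
have f_inj := can_inj fK.
split; first by exists g.
have UE v : ~~ light v -> f @: block v = Ublock (10 * m) 5 (rk v).+1.
  move=> hv; apply/setP => k; rewrite -(gK k) mem_imset // mem_block // inE.
  have hy := home_heavy (g k).
  have -> : (home (g k) == v) = (rk (home (g k)) == rk v).
    by apply/eqP/eqP => [->//|e]; rewrite -(rkK hy) e rkK.
  have := pos_lt5 (g k); rewrite /= /code.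
  by move: (rk _) (rk v) (pos _) => r s p; clear; lia.
(* Labels start at 1, so the code 5r + 4 of a heavy vertex of rank r carries the label 5(r + 1). *)
have LE v : ~~ light v -> f @: [set v] = lab (10 * m) (5 * (rk v).+1).
  move=> hv; apply/setP => k; rewrite -(gK k) mem_imset // !inE /= /code.
  have hy := home_heavy (g k).
  have [ly|hg] := boolP (light (g k)).
    rewrite (_ : g k == v = false); last by apply: contraTF ly => /eqP->.
    have := pos_light ly; move: (rk _) (rk v) (pos _) => r s p; clear; lia.
  rewrite /pos /home (negPf hg).
  have -> : (g k == v) = (rk (g k) == rk v).
    by apply/eqP/eqP => [->//|e]; rewrite -(rkK hg) e rkK.
  by move: (rk _) (rk v) => r s; clear; lia.
have kE : (10 * m) %/ (2 * 5) = m by rewrite mulKn.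
apply/setP => S; have -> : S = f @: (g @: S).
  by rewrite -imset_comp (eq_imset _ gK) imset_id.
move: (g @: S) => A; rewrite mem_imset; last exact: imset_inj.
rewrite /F0 kE !inE.
have subE v : ~~ light v ->
    (f @: A \subset Ublock (10 * m) 5 (rk v).+1) = (A \subset block v).
  move=> hv; rewrite -UE //; apply/subsetP/subsetP => sub y.
    by move=> yA; rewrite -(mem_imset _ _ f_inj) sub // imset_f.
  by case/imsetP => z zA ->; rewrite imset_f // sub.
have imD v : f @: (block v :\ v) = f @: block v :\: f @: [set v].
  by apply/setP => k; rewrite -(gK k) in_setD !mem_imset // in_setD.
have rk2 v : ~~ light v -> rk v < 2 * m by rewrite mul2n; apply: rk_lt.
apply/idP/idP => [|].
  case/(extremal_mem A (ex_intro _ x0 isT)) => v hv [/andP[Ab A3]|AE|AE].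
  - apply/orP; left; apply/orP; left; apply/existsP; exists (Ordinal (rk2 v hv)).
    by rewrite /= subE // Ab card_imset.
  - apply/orP; left; apply/orP; right; apply/existsP; exists (Ordinal (rk2 v hv)).
    by rewrite /= -UE // -LE // -imD blockD1 AE.
  apply/orP; right; apply/existsP.
  (* The pair may be named by either of its vertices; [F0] asks for an odd index, which is an even
     rank. *)
  wlog ev : v hv AE / ~~ odd (rk v).
    have [hn hh] := hnbP v.
    move=> W; have [ov|] := boolP (odd (rk v)); last exact: W.
    apply: (W (hnb v)) => //; last exact: odd_rk_hnb.
    by rewrite hnbK // AE setUC.
  exists (Ordinal (rk2 v hv)); rewrite /= ev /= -(LE v hv) -rk_hnb // -LE; last by case: (hnbP v).
  by rewrite -imsetU AE.
move=> SF; apply/(extremal_mem A (ex_intro _ x0 isT)); move: SF.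
have unrk2 (i : 'I_(2 * m)) : ~~ light (unrk i) /\ rk (unrk i) = i.
  by have im : i < m.*2; [rewrite -mul2n|rewrite unrk_heavy ?unrkK].
case/orP => [/orP[]|] /existsP[i]; have [hv ri] := unrk2 i => p;
  exists (unrk i) => //; move: (unrk i) hv ri => v hv ri.
- move: p; rewrite -ri => /andP[p1 p2].
  by constructor 1; apply/andP; split; [rewrite -subE|rewrite -(card_imset _ f_inj)].
- move: p => /eqP; rewrite -ri -UE // -LE // -imD blockD1 => /imset_inj AE.
  by constructor 2; apply: AE.
move: p => /andP[/= oi /eqP]; rewrite -ri in oi *.
rewrite -(LE _ hv) -rk_hnb // -LE; last by case: (hnbP v).
by rewrite -imsetU => /imset_inj AE; constructor 3; apply: AE.
Qed.

End Extremal.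

End Hereditary.

Theorem mainTheorem4 (n : nat) (V : finType) (F : {set {set V}}) :
  0 < n -> #|V| = n ->
  hereditary F -> min_degree_ge F 12 ->
  10 * #|F| <= 53 * n + 10 ->
  [/\ 10 %| n,
      10 * #|F| = 53 * n + 10 &
      exists f : V -> 'I_n,
        bijective f /\ [set f @: A | A : {set V} in F] = F0 n 5].
Proof.
move=> n0 cV herF degF Fle; rewrite -cV in n0 Fle.
have [Feq _] := discharge_eq herF degF n0 Fle.
have types := extremal_types herF degF n0 Fle.
have /card_gt0P[x0 _] := n0.
have [m [f [f_bij fF]]] := extremal_iso herF degF types x0.
have nE : n = 10 * m by rewrite -cV (bij_eq_card f_bij) card_ord.
rewrite cV in Feq; subst n; rewrite nE in Feq *.
by split; [apply: dvdn_mulr|exact: Feq|exists f].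
Qed.
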